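(* Let $n\ge 3$ and $k\ge 2$ be integers, let $P_n$ be the Artin pure braid group on $n$ strands, and let $F_k$ be the free group of rank $k$. (1) If $k\ge 3$, there are no epimorphisms from $P_n$ to $F_k$. (2) If $k=2$, there is a single equivalence class of epimorphisms from $P_n$ to $F_2$; that is, epimorphisms $P_n\to F_2$ exist, and any two epimorphisms $P_n\to F_2$ are equivalent.
   Context: The Artin braid group $B_n$ has generators $\sigma_1,\dots,\sigma_{n-1}$ and relations $\sigma_i\sigma_{i+1}\sigma_i=\sigma_{i+1}\sigma_i\sigma_{i+1}$ for $1\le i\le n-2$ and $\sigma_j\sigma_i=\sigma_i\sigma_j$ for $|j-i|\ge 2$. The Artin pure braid group is $P_n=\ker(B_n\to\Sigma_n)$, the kernel of the natural map to the symmetric group $\Sigma_n$ sending $\sigma_i$ to the transposition $(i\ i{+}1)$. Two surjective homomorphisms $f,g\colon G\to H$ are called equivalent if there are automorphisms $\phi\in\mathrm{Aut}(G)$ and $\psi\in\mathrm{Aut}(H)$ such that $g\circ\phi=\psi\circ f$. *)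

(* Defs.v *)
From HB Require Import structures.
From mathcomp Require Import all_boot all_fingroup.
From mathcomp Require Import generic_quotient boolp zify.

Set Implicit Arguments.
Unset Strict Implicit.
Unset Printing Implicit Defensive.

Local Open Scope group_scope.
Local Open Scope quotient_scope.

Notation group_hom := UMagmaMorphism.type.

Definition surjective (T U : Type) (f : T -> U) : Prop :=
  forall y : U, exists x : T, f x = y.

Definition equivalent_epi (G H : groupType) (f g : group_hom G H) : Prop :=
  exists (phi : group_hom G G) (psi : group_hom H H),
    [/\ bijective phi, bijective psi & forall x : G, g (phi x) = psi (f x)].

(* The letter (i, false) stands for the generator x_i, and (i, true) for its
   formal inverse. *)
Definition letter (I : Type) : Type := (I * bool)%type.
Definition word (I : Type) : Type := seq (letter I).

Definition gen (I : Type) (i : I) : letter I := (i, false).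
Definition inv_letter (I : Type) (a : letter I) : letter I := (a.1, ~~ a.2).
Definition inv_word (I : Type) (w : word I) : word I :=
  rev (map (@inv_letter I) w).

Inductive pres_eq (I : Type) (R : word I -> word I -> Prop) :
    word I -> word I -> Prop :=
| pres_eq_rel u v : R u v -> pres_eq R u v
| pres_eq_cancel a : pres_eq R [:: a; inv_letter a] [::]
| pres_eq_refl u : pres_eq R u u
| pres_eq_sym u v : pres_eq R u v -> pres_eq R v u
| pres_eq_trans u v w : pres_eq R u v -> pres_eq R v w -> pres_eq R u w
| pres_eq_cat u u' v v' :
    pres_eq R u u' -> pres_eq R v v' -> pres_eq R (u ++ v) (u' ++ v').

Section PresentedGroup.
Variables (I : choiceType) (R : word I -> word I -> Prop).

Definition pres_eqb (u v : word I) : bool := `[< pres_eq R u v >].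

Lemma pres_eqb_refl : reflexive pres_eqb.
Proof. by move=> u; apply/asboolP; exact: pres_eq_refl. Qed.

Lemma pres_eqb_sym : symmetric pres_eqb.
Proof.
by move=> u v; apply/asboolP/asboolP => uv; exact: pres_eq_sym.
Qed.

Lemma pres_eqb_trans : transitive pres_eqb.
Proof.
by move=> v u w /asboolP uv /asboolP vw; apply/asboolP/(pres_eq_trans uv vw).
Qed.

Canonical pres_equiv :=
  EquivRel pres_eqb pres_eqb_refl pres_eqb_sym pres_eqb_trans.

(* The group presented by the generators x_i, i in I, and the relations u = v
   for all words u, v such that R u v. *)
Definition presented : Type := {eq_quot pres_equiv}.

HB.instance Definition _ := EqQuotient.on presented.
HB.instance Definition _ := Choice.on presented.

Definition pres_class (w : word I) : presented := \pi_presented w.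

Lemma pres_classP (u v : word I) : pres_class u = pres_class v <-> pres_eq R u v.
Proof.
split=> [/eqP|uv]; first by rewrite /pres_class eqmodE => /asboolP.
by apply/eqP; rewrite /pres_class eqmodE; apply/asboolP.
Qed.

Lemma pres_class_repr (x : presented) : pres_class (repr x) = x.
Proof. exact: reprK. Qed.

Lemma repr_pres_class (w : word I) : pres_eq R (repr (pres_class w)) w.
Proof. by apply/pres_classP; exact: pres_class_repr. Qed.

Definition pres_mul (x y : presented) : presented :=
  pres_class (repr x ++ repr y).
Definition pres_one : presented := pres_class [::].
Definition pres_inv (x : presented) : presented := pres_class (inv_word (repr x)).

Lemma inv_letterK : involutive (@inv_letter I).
Proof. by case=> i b; rewrite /inv_letter /= negbK. Qed.

Lemma pres_mulE u v : pres_mul (pres_class u) (pres_class v) = pres_class (u ++ v).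
Proof. by apply/pres_classP/pres_eq_cat; exact: repr_pres_class. Qed.

Lemma pres_mulA : associative pres_mul.
Proof.
move=> x y z; rewrite -(pres_class_repr x) -(pres_class_repr y) -(pres_class_repr z).
by rewrite !pres_mulE catA.
Qed.

Lemma pres_mul1 : left_id pres_one pres_mul.
Proof. by move=> x; rewrite -(pres_class_repr x) pres_mulE. Qed.

Lemma pres_mulr1 : right_id pres_one pres_mul.
Proof. by move=> x; rewrite -(pres_class_repr x) pres_mulE cats0. Qed.

Lemma pres_eq_mulV (w : word I) : pres_eq R (w ++ inv_word w) [::].
Proof.
elim: w => [|a w IHw]; first exact: pres_eq_refl.
rewrite /inv_word /= rev_cons -cats1 catA -cat1s.
apply: pres_eq_trans (pres_eq_cancel R a); rewrite -[[:: a; _]]cat1s.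
apply: (pres_eq_cat (pres_eq_refl _ [:: a])).
rewrite -[X in pres_eq _ _ X]cat0s.
exact: pres_eq_cat IHw (pres_eq_refl _ _).
Qed.

Lemma inv_wordK : involutive (@inv_word I).
Proof. by move=> w; rewrite /inv_word map_rev revK (mapK inv_letterK). Qed.

Lemma pres_mulV : right_inverse pres_one pres_inv pres_mul.
Proof.
move=> x; rewrite -{1}(pres_class_repr x) pres_mulE.
by apply/pres_classP; exact: pres_eq_mulV.
Qed.

Lemma pres_mulVl : left_inverse pres_one pres_inv pres_mul.
Proof.
move=> x; rewrite -{2}(pres_class_repr x) pres_mulE.
by apply/pres_classP; rewrite -{2}(inv_wordK (repr x)); exact: pres_eq_mulV.
Qed.

HB.instance Definition _ := isGroup.Build presented
  pres_mulA pres_mul1 pres_mulr1 pres_mulVl pres_mulV.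

End PresentedGroup.

Section PresentedLift.
Variables (I : choiceType) (R : word I -> word I -> Prop).
Variables (G : groupType) (h : I -> G).

Definition eval_letter (a : letter I) : G := if a.2 then (h a.1)^-1 else h a.1.

Definition eval_word (w : word I) : G :=
  foldr (fun a x => eval_letter a * x) 1 w.

Lemma eval_word_cat u v : eval_word (u ++ v) = eval_word u * eval_word v.
Proof.
by elim: u => [|a u IHu] /=; rewrite ?mul1g // IHu mulgA.
Qed.

Hypothesis hR : forall u v, R u v -> eval_word u = eval_word v.

Lemma eval_word_pres_eq u v : pres_eq R u v -> eval_word u = eval_word v.
Proof.
elim=> {u v} [u v /hR //|[i b]|//|u v _ -> //|u v w _ -> _ -> //|].
  by case: b; rewrite /= /eval_letter /= mulg1 ?mulVg ?mulgV.
by move=> u u' v v' _ Eu _ Ev; rewrite !eval_word_cat Eu Ev.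
Qed.

(* The homomorphism x_i |-> h i; the relations hold in G by hR. *)
Definition pres_lift (x : presented R) : G := eval_word (repr x).

Lemma pres_liftE (w : word I) : pres_lift (pres_class R w) = eval_word w.
Proof. exact: eval_word_pres_eq (repr_pres_class _ _). Qed.

Lemma pres_liftM (x y : presented R) :
  pres_lift (x * y) = pres_lift x * pres_lift y.
Proof. by rewrite pres_liftE eval_word_cat. Qed.

Lemma pres_lift1 : pres_lift 1 = 1.
Proof. by rewrite pres_liftE. Qed.

End PresentedLift.

Definition no_relation (I : Type) (u v : word I) : Prop := False.

Definition free_group (k : nat) : groupType := presented (@no_relation 'I_k).

(* Generators are numbered from 0: i : 'I_n.-1 stands for sigma_(i+1). *)
Inductive braid_rel (n : nat) : word 'I_n.-1 -> word 'I_n.-1 -> Prop :=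
| braid_rel_braid (i j : 'I_n.-1) : j = i.+1 :> nat ->
    braid_rel [:: gen i; gen j; gen i] [:: gen j; gen i; gen j]
| braid_rel_comm (i j : 'I_n.-1) : (i.+2 <= j)%N || (j.+2 <= i)%N ->
    braid_rel [:: gen j; gen i] [:: gen i; gen j].

Definition braid_group (n : nat) : groupType := presented (@braid_rel n).

Lemma ltn_strand (n : nat) (i : 'I_n.-1) : (i < n)%N.
Proof. exact: leq_trans (ltn_ord i) (leq_pred n). Qed.

Lemma ltn_strandS (n : nat) (i : 'I_n.-1) : (i.+1 < n)%N.
Proof. by case: n i => [|n] [i]. Qed.

Definition adj_transposition (n : nat) (i : 'I_n.-1) : 'S_n :=
  tperm (Ordinal (ltn_strand i)) (Ordinal (ltn_strandS i)).

Lemma tperm_braid (T : finType) (a b c : T) : a != b -> b != c -> a != c ->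
  tperm a b * (tperm b c * tperm a b) = tperm b c * (tperm a b * tperm b c).
Proof.
move=> ab bc ac.
rewrite -{1}(tpermV a b) -{2}(tpermV b c).
rewrite -[LHS]/(tperm b c ^ tperm a b) -[RHS]/(tperm a b ^ tperm b c) !tpermJ.
by rewrite tpermR tpermL !tpermD 1?eq_sym // 1?eq_sym.
Qed.

Lemma tperm_comm (T : finType) (a b c d : T) :
    a != c -> a != d -> b != c -> b != d ->
  tperm a b * tperm c d = tperm c d * tperm a b.
Proof.
move=> ac ad bc bd; apply/commgP/conjg_fixP.
by rewrite tpermJ !tpermD // eq_sym.
Qed.

Lemma braid_rel_perm (n : nat) (u v : word 'I_n.-1) : braid_rel u v ->
  eval_word (@adj_transposition n) u = eval_word (@adj_transposition n) v.
Proof.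
case=> [i j ij|i j ij]; rewrite /= /eval_letter /= !mulg1 /adj_transposition.
  have -> : Ordinal (ltn_strand j) = Ordinal (ltn_strandS i) by exact: val_inj.
  by apply: tperm_braid; rewrite -val_eqE /=; lia.
by apply: tperm_comm; rewrite -val_eqE /=; lia.
Qed.

Definition braid_perm (n : nat) : braid_group n -> 'S_n :=
  pres_lift (@adj_transposition n).

HB.instance Definition _ (n : nat) :=
  isUMagmaMorphism.Build (braid_group n) 'S_n (@braid_perm n)
    (conj (pres_lift1 (@braid_rel_perm n)) (pres_liftM (@braid_rel_perm n))).

Lemma braid_perm_gen (n : nat) (i : 'I_n.-1) :
  braid_perm (pres_class _ [:: gen i]) = adj_transposition i.
Proof. by rewrite /braid_perm (pres_liftE (@braid_rel_perm n)) /= mulg1. Qed.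

Section Kernel.
Variables (G H : groupType) (f : group_hom G H).

Definition in_kernel : pred G := fun x => f x == 1.

Lemma in_kernel_closed : group_closed in_kernel.
Proof.
split; first by rewrite /in_kernel unfold_in gmulf1.
move=> x y; rewrite !unfold_in => /eqP fx /eqP fy.
by rewrite gmulfF fx fy divgg.
Qed.

Definition group_kernel : Type := {x : G | in_kernel x}.

HB.instance Definition _ := SubChoice.on group_kernel.
HB.instance Definition _ :=
  SubChoice_isSubGroup.Build G in_kernel group_kernel in_kernel_closed.

End Kernel.

Definition pure_braid_group (n : nat) : groupType := group_kernel (@braid_perm n).

(* Main.v *)
Require Import Defs.
From mathcomp Require Import all_boot all_fingroup.
From HB Require Import structures.
From mathcomp Require Import all_order all_algebra.
From mathcomp Require Import generic_quotient boolp zify ring lra.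

Set Implicit Arguments.
Unset Strict Implicit.
Unset Printing Implicit Defensive.

(* Nontrivial elements of a free group have abelian centralizers, as one sees in
   the faithful representation by 2 x 2 integer matrices given by ping-pong.
   Let f map P_n to a free group with nonabelian image, and let A_ij be the
   standard generators. Then f (A_ij) and f (A_jk) fail to commute for some
   i, j, k, since otherwise all f (A_ij) would commute; after conjugation by a
   braid, these are u = f (A_01) and v = f (A_12). Every pure braid commuting
   with A_01 and A_12 is killed by f, in particular A_ij for i, j >= 3 and the
   loops A_2k A_1k A_0k. As f (A_2k) commutes with u and f (A_0k) with v, the
   three elements f (A_0k), f (A_1k), f (A_2k) are all trivial as soon as the
   first or the last is. If they are nontrivial for some k, take k to be the last
   strand and compose f with the automorphism of P_n exchanging this strand with
   the boundary of the disc, regarded as a further puncture of the sphere; then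
   they become trivial for all k. So up to automorphisms of P_n, f kills every
   A_ij except those on the strands 0, 1, 2, and hence factors through the
   projection of P_n onto P_3 modulo its center, which is free of rank 2. The
   theorem follows because free groups are Hopfian. *)

(** * Free groups *)

Import GRing.Theory Num.Theory Order.Theory.

(** * The group $SL_2$ over a commutative ring *)

Section SL2.
Local Open Scope ring_scope.
Variable R : comNzRingType.

Definition mat2 : Type := (R * R * R * R)%type.

Definition det2 (m : mat2) : R := let: (a, b, c, d) := m in a * d - b * c.

Definition mul2 (m n : mat2) : mat2 :=
  let: (a, b, c, d) := m in let: (a', b', c', d') := n in
  (a * a' + b * c', a * b' + b * d', c * a' + d * c', c * b' + d * d').

Definition adj2 (m : mat2) : mat2 := let: (a, b, c, d) := m in (d, - b, - c, a).

Lemma det2_mul m n : det2 (mul2 m n) = det2 m * det2 n.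
Proof. by case: m => [[[a b] c] d]; case: n => [[[a' b'] c'] d'] /=; ring. Qed.

Lemma det2_adj m : det2 (adj2 m) = det2 m.
Proof. by case: m => [[[a b] c] d] /=; ring. Qed.

Definition sl2 : Type := {m : mat2 | det2 m == 1}.
HB.instance Definition _ := SubChoice.on sl2.

Lemma sl2_mul_subproof (x y : sl2) : det2 (mul2 (val x) (val y)) == 1.
Proof. by rewrite det2_mul (eqP (valP x)) (eqP (valP y)) mulr1. Qed.

Lemma sl2_inv_subproof (x : sl2) : det2 (adj2 (val x)) == 1.
Proof. by rewrite det2_adj (valP x). Qed.

Lemma sl2_one_subproof : det2 (1, 0, 0, 1) == 1.
Proof. by rewrite /= mulr1 mulr0 subr0. Qed.

Definition sl2_mul (x y : sl2) : sl2 := exist (fun m => det2 m == 1) _ (sl2_mul_subproof x y).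
Definition sl2_inv (x : sl2) : sl2 := exist (fun m => det2 m == 1) _ (sl2_inv_subproof x).
Definition sl2_one : sl2 := exist (fun m => det2 m == 1) _ sl2_one_subproof.

Lemma sl2_mulA : associative sl2_mul.
Proof.
move=> x y z; apply: val_inj; rewrite /=.
case: (val x) (val y) (val z) => [[[a b] c] d] [[[a' b'] c'] d'] [[[e f] g] h] /=.
by congr (_, _, _, _); ring.
Qed.

Lemma sl2_mul1 : left_id sl2_one sl2_mul.
Proof.
move=> x; apply: val_inj; rewrite /=; case: (val x) => [[[a b] c] d] /=.
by congr (_, _, _, _); ring.
Qed.

Lemma sl2_mulr1 : right_id sl2_one sl2_mul.
Proof.
move=> x; apply: val_inj; rewrite /=; case: (val x) => [[[a b] c] d] /=.
by congr (_, _, _, _); ring.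
Qed.

Lemma sl2_mulV : right_inverse sl2_one sl2_inv sl2_mul.
Proof.
case=> [[[[a b] c] d] /= h]; apply: val_inj => /=; move/eqP: h => h.
by congr (_, _, _, _); rewrite -?h; ring.
Qed.

Lemma sl2_mulVl : left_inverse sl2_one sl2_inv sl2_mul.
Proof.
case=> [[[[a b] c] d] /= h]; apply: val_inj => /=; move/eqP: h => h.
by congr (_, _, _, _); rewrite -?h; ring.
Qed.

HB.instance Definition _ :=
  isGroup.Build sl2 sl2_mulA sl2_mul1 sl2_mulr1 sl2_mulVl sl2_mulV.

(* The parabolic fixing d on the projective line: (p, q) |-> (p', q') with
   p' - d q' = p - d q and q' = q + 4 (p - d q). *)
Definition parabolic2 (d : R) : mat2 :=
  (1 + 4 * d, - 4 * d ^+ 2, 4, 1 - 4 * d).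

Lemma det2_parabolic d : det2 (parabolic2 d) == 1.
Proof. by rewrite /=; apply/eqP; ring. Qed.

Definition parabolic d : sl2 := exist (fun m => det2 m == 1) _ (det2_parabolic d).

Definition transvection : sl2.
Proof. by exists (1, 1, 0, 1); rewrite /= mulr0 mulr1 subr0. Defined.

Lemma transvection_neq1 : transvection != 1%g.
Proof.
by apply/eqP => /(congr1 val) [] /eqP; rewrite oner_eq0.
Qed.

Definition scalar2 (m : mat2) : bool :=
  let: (a, b, c, d) := m in [&& b == 0, c == 0 & a == d].

End SL2.

HB.instance Definition _ (R : finComNzRingType) := [Finite of sl2 R by <:].

Section SL2Map.
Local Open Scope ring_scope.
Variables (R S : comNzRingType) (f : {rmorphism R -> S}).

Definition map2 (m : mat2 R) : mat2 S :=
  let: (a, b, c, d) := m in (f a, f b, f c, f d).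

Lemma det2_map (x : sl2 R) : det2 (map2 (val x)) == 1.
Proof.
have := eqP (valP x); case: (val x) => [[[a b] c] d] /= h.
by rewrite -!rmorphM -rmorphB h rmorph1.
Qed.

Definition sl2_map (x : sl2 R) : sl2 S := exist (fun m => det2 m == 1) _ (det2_map x).

Lemma sl2_mapM : {morph sl2_map : x y / (x * y)%g >-> (x * y)%g}.
Proof.
move=> x y; apply: val_inj; rewrite /=.
case: (val x) (val y) => [[[a b] c] d] [[[a' b'] c'] d'] /=.
by rewrite !rmorphD !rmorphM.
Qed.

Lemma sl2_map1 : sl2_map 1%g = 1%g.
Proof. by apply: val_inj; rewrite /= !rmorph0 !rmorph1. Qed.

HB.instance Definition _ :=
  isUMagmaMorphism.Build (sl2 R) (sl2 S) sl2_map (conj sl2_map1 sl2_mapM).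

End SL2Map.

(** Over the fraction field, $(x,y)$ and $(x',y')$ are both multiples of $(q,r)$, so their minor
    vanishes; multiplying by $k^2$ avoids the fractions. *)
Lemma proportional_minor (R : idomainType) (k t t' q r x y x' y' : R) :
  (k != 0 -> x * k = t * q -> y * k = t * r -> x' * k = t' * q ->
   y' * k = t' * r -> x * y' = x' * y)%R.
Proof.
move=> nk xk yk xk' yk'; apply: (mulIf nk); apply: (mulIf nk).
have -> : (x * y' * k * k = (x * k) * (y' * k))%R by ring.
have -> : (x' * y * k * k = (x' * k) * (y * k))%R by ring.
by rewrite xk yk xk' yk'; ring.
Qed.

(* x commutes with y iff the vectors of off-diagonal entries and of differences
   of diagonal entries of x and y are proportional. *)
Lemma sl2_commute_proportional (x y : sl2 int) : commute x y ->
  let: (a, b, c, d) := val x in let: (p, q, r, s) := val y in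
  [/\ b * r = c * q, b * (p - s) = (a - d) * q & c * (p - s) = (a - d) * r]%R.
Proof.
move=> /(congr1 val) /=; case: (val x) (val y) => [[[a b] c] d] [[[p q] r] s] /=.
move=> [x1 x2 x3 x4]; split.
- by apply: (addrI (a * p)%R); rewrite x1; ring.
- apply: (addrI (b * s + d * q)%R); transitivity (p * b + q * d)%R; first by ring.
  by rewrite -x2; ring.
- apply: (addrI (c * s + d * r)%R); transitivity (c * p + d * r)%R; first by ring.
  by rewrite x3; ring.
Qed.

(** A non-scalar [y] has a nonzero vector of off-diagonal entries and diagonal difference. Those of
    [x] and [z] are proportional to it, hence to each other; the three cases correspond to the
    coordinate of [y] that is nonzero. *)
Lemma sl2_commute_trans (x y z : sl2 int) : ~~ scalar2 (val y) ->
  commute x y -> commute y z -> commute x z.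
Proof.
move=> ny /sl2_commute_proportional xy /commute_sym /sl2_commute_proportional zy.
apply: val_inj; move: xy zy ny; rewrite /=.
case: (val x) (val y) (val z) => [[[a b] c] d].
move=> [[[p q] r] s] [[[a' b'] c'] d'] /= [e1 e2 e3] [f1 f2 f3].
rewrite -(subr_eq0 p) !negb_and => /or3P nz.
have [g1 g2 g3] : [/\ b * c' = b' * c, b * (a' - d') = b' * (a - d)
    & c * (a' - d') = c' * (a - d)]%R.
  case: nz => nz.
  - split.
    + exact: (proportional_minor nz erefl (esym e1) erefl (esym f1)).
    + exact: (proportional_minor nz erefl (esym e2) erefl (esym f2)).
    + exact: (proportional_minor nz (esym e1) (esym e2) (esym f1) (esym f2)).
  - split.
    + exact: (proportional_minor nz e1 erefl f1 erefl).
    + exact: (proportional_minor nz e1 (esym e3) f1 (esym f3)).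
    + exact: (proportional_minor nz erefl (esym e3) erefl (esym f3)).
  - split.
    + exact: (proportional_minor nz e2 e3 f2 f3).
    + exact: (proportional_minor nz e2 erefl f2 erefl).
    + exact: (proportional_minor nz e3 erefl f3 erefl).
congr (_, _, _, _).
- by rewrite g1; ring.
- apply: (addrI (- (a' * b + b * d'))%R).
  by transitivity (b' * (a - d) - b * (a' - d') + (a' * b + b' * d)
    - (a' * b + b * d'))%R; [ring | rewrite g2; ring].
- apply: (addrI (- (c' * a + d * c'))%R).
  by transitivity (c * (a' - d') - c' * (a - d) + (c' * a + d' * c)
    - (c' * a + d * c'))%R; [ring | rewrite g3; ring].
- by transitivity (b' * c + d * d')%R; [ring | rewrite -g1; ring].
Qed.

(** * Reduced words *)

Section Reduced.
Variable I : eqType.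
Implicit Types (a b : letter I) (w : word I).

Definition consistent a b : bool := b != inv_letter a.

Definition reduced w : bool := sorted consistent w.

Definition cons_reduce a w : word I :=
  if w is b :: w' then if consistent a b then a :: w else w' else [:: a].

Definition reduce w : word I := foldr cons_reduce [::] w.

Lemma reduced_reduce w : reduced (reduce w).
Proof.
elim: w => [//|a w /=]; rewrite /reduced; case: (reduce w) => [//|b v] /= vP.
by case: ifP => [/= -> //|_]; exact: path_sorted vP.
Qed.

Lemma pres_eq_reduce (R : word I -> word I -> Prop) w : pres_eq R (reduce w) w.
Proof.
elim: w => [|a w IHw] /=; first exact: pres_eq_refl.
apply: (@pres_eq_trans _ _ _ (a :: reduce w)); last first.
  exact: (pres_eq_cat (pres_eq_refl _ [:: a]) IHw).
case: (reduce w) => [|b v] /=; first exact: pres_eq_refl.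
rewrite /consistent; case: eqP => [->|_] /=; last exact: pres_eq_refl.
apply: pres_eq_sym.
exact: (pres_eq_cat (pres_eq_cancel R a) (pres_eq_refl _ v)).
Qed.

End Reduced.

(** * Ping-pong for integer matrices *)

Section PingPong.
Local Open Scope ring_scope.

Definition act2 (m : mat2 int) (v : int * int) : int * int :=
  let: (a, b, c, d) := m in (a * v.1 + b * v.2, c * v.1 + d * v.2).

Lemma act2_mul m n v : act2 (mul2 m n) v = act2 m (act2 n v).
Proof.
case: m n => [[[a b] c] d] [[[a' b'] c'] d'] /=.
by congr (_, _); ring.
Qed.

Definition int_of_letter k (a : letter 'I_k) : int := (a.1 : nat)%:R.

Definition sign_of_letter k (a : letter 'I_k) : int := if a.2 then -1 else 1.

(* The vectors (p, q) with q / (p - i q) > 2 for the letter x_i, and < -2 for its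
   inverse. *)
Definition attracted k (a : letter 'I_k) (v : int * int) : Prop :=
  let r := v.1 - int_of_letter a * v.2 in let y := sign_of_letter a * v.2 in
  0 < r /\ 2 * r < y \/ r < 0 /\ y < 2 * r.

Definition rho k := eval_letter (fun i : 'I_k => parabolic (i : nat)%:R : sl2 int).

Lemma act_letter k (a : letter 'I_k) v :
  let v' := act2 (val (rho a)) v in
  v'.2 = v.2 + 4 * sign_of_letter a * (v.1 - int_of_letter a * v.2) /\
  v'.1 - int_of_letter a * v'.2 = v.1 - int_of_letter a * v.2.
Proof.
rewrite /rho /eval_letter /sign_of_letter /int_of_letter.
by case: a => i [] /=; split; ring.
Qed.

Lemma attracted_start k (a : letter 'I_k) : attracted a (act2 (val (rho a)) (1, 0)).
Proof.
rewrite /attracted; have [-> ->] := act_letter a (1, 0); rewrite /= mulr0 subr0.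
by rewrite /sign_of_letter; case: ifP => _; lia.
Qed.

(** A letter adds 4 to the ratio of [y] to [r] and fixes [r]. If both letters have the same index,
    the ratio was already above 2; otherwise it was below 2 in absolute value, because distinct
    integer fixed points lie at distance at least 1. *)
Lemma attracted_step k (a b : letter 'I_k) v : consistent a b ->
  attracted b v -> attracted a (act2 (val (rho a)) v).
Proof.
rewrite /attracted; have [-> ->] := act_letter a v.
case: v => p q /=; rewrite /int_of_letter /sign_of_letter.
case: a b => i s [j t]; rewrite /consistent /inv_letter /= xpair_eqE.
have [->|ji] /= := eqVneq j i.
  by case: s; case: t => //= _; lia.
move=> _; rewrite !natz; set d : int := (i : nat)%:Z; set e : int := (j : nat)%:Z.
(* Hiding the product [(e - d) * q] behind [g], with only this bound kept, leaves a problem of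
   linear arithmetic. *)
have [g -> gq] : exists2 g, p - d * q = (p - e * q) + g & `|q| <= `|g|.
  exists ((e - d) * q); first by ring.
  rewrite normrM ler_peMl // /d /e.
  by move/eqP: ji => ji; have : (j : nat) <> i by [move/val_inj]; lia.
by move: (p - e * q) => r; case: s; case: t => /=; lia.
Qed.

Lemma attracted_reduced k (a : letter 'I_k) w : reduced (a :: w) ->
  attracted a (act2 (val (eval_word (fun i : 'I_k => parabolic (i : nat)%:R : sl2 int) (a :: w))) (1, 0)).
Proof.
elim: w a => [|b w IHw] a.
  by move=> _; rewrite -[eval_word _ _]/(rho a * 1)%g mulg1; exact: attracted_start.
move=> /andP[ab bw]; rewrite -[eval_word _ _]/(rho a * _)%g act2_mul.
by apply: attracted_step ab (IHw _ bw).
Qed.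

(** A scalar matrix keeps the second coordinate of $(1,0)$ zero, whereas attracted vectors have a
    nonzero one. *)
Lemma scalar2_attracted k (a : letter 'I_k) m : scalar2 m -> ~ attracted a (act2 m (1, 0)).
Proof.
case: m => [[[p q] r] s] /and3P[_ /eqP-> _].
by rewrite /attracted /sign_of_letter /=; case: ifP; lia.
Qed.

End PingPong.

Section FreeGroup.
Local Open Scope group_scope.
Variable k : nat.

Definition fgen (i : 'I_k) : free_group k := pres_class _ [:: gen i].

Section Lift.
Variables (G : groupType) (h : 'I_k -> G).

Let no_relation_eval (u v : word 'I_k) :
  no_relation u v -> eval_word h u = eval_word h v.
Proof. by []. Qed.

Definition free_lift : free_group k -> G := pres_lift h.

HB.instance Definition _ := isUMagmaMorphism.Build (free_group k) G free_lift
  (conj (pres_lift1 no_relation_eval) (pres_liftM no_relation_eval)).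

Lemma free_lift_class w : free_lift (pres_class _ w) = eval_word h w.
Proof. exact: (pres_liftE no_relation_eval). Qed.

Lemma free_lift_gen i : free_lift (fgen i) = h i.
Proof. by rewrite free_lift_class /= mulg1. Qed.

End Lift.

Lemma free_hom_ext (G : groupType) (f g : group_hom (free_group k) G) :
  (forall i, f (fgen i) = g (fgen i)) -> f =1 g.
Proof.
move=> fg x; rewrite -(pres_class_repr x); elim: (repr x) => [|[i b] w IHw].
  by rewrite -[pres_class _ _]/(1 : free_group k) !gmulf1.
rewrite -cat1s -[pres_class _ _]pres_mulE -[pres_mul _ _]/(_ * _ : free_group k).
rewrite !gmulfM IHw; congr (_ * _); case: b; last exact: fg.
have -> : pres_class (@no_relation 'I_k) [:: (i, true)] = (fgen i)^-1.
  apply/esym/mulg1_eq; rewrite /fgen -[_ * _]/(pres_mul _ _) pres_mulE.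
  exact/pres_classP/pres_eq_cancel.
by rewrite !gmulfV fg.
Qed.

(** Over the integers this is the faithful ping-pong representation; over $\mathbb{Z}/N$ its target
    is finite, which gives residual finiteness. *)
Definition sl2_rep (R : comNzRingType) : group_hom (free_group k) (sl2 R) :=
  free_lift (fun i : 'I_k => parabolic (i : nat)%:R%R).

Lemma sl2_rep_scalar (x : free_group k) : scalar2 (val (sl2_rep int x)) -> x = 1.
Proof.
rewrite -(pres_class_repr x).
have <- : pres_class (@no_relation 'I_k) (reduce (repr x)) = pres_class _ (repr x).
  exact/pres_classP/pres_eq_reduce.
rewrite /= free_lift_class; have := reduced_reduce (repr x).
case: (reduce _) => [//|a w] /attracted_reduced aw sc.
by case: (scalar2_attracted sc aw).
Qed.

(** The property is inherited from [sl2 int], since by [sl2_rep_scalar] the representation is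
    faithful and a nontrivial element never has a scalar image. *)
Lemma free_commute_trans (x y z : free_group k) : y != 1 ->
  commute x y -> commute y z -> commute x z.
Proof.
move=> ny /(gmulf_commute (sl2_rep int)) xy /(gmulf_commute (sl2_rep int)) yz.
have inj : injective (sl2_rep int).
  apply: gmulf_inj => t t1; apply: sl2_rep_scalar.
  by rewrite t1 /= !eqxx.
apply: inj; rewrite !gmulfM; apply: sl2_commute_trans xy yz.
by apply: contra ny => /sl2_rep_scalar ->.
Qed.

End FreeGroup.

(** * Residual finiteness, rank and the Hopf property *)

Section Hopf.
Local Open Scope group_scope.

Lemma Zp_intr_eq0 (m : int) :
  (forall N, (1 < N)%N -> (m%:~R : 'Z_N)%R = 0%R) -> m = 0%R.
Proof.
have nat_eq0 (n : nat) : (forall N, (1 < N)%N -> (n%:R : 'Z_N)%R = 0%R) -> n = 0%N.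
  (* The modulus $n+2$ exceeds both 1 and $n$, so the residue is $n$ itself. *)
  move=> /(_ n.+2 isT) /(congr1 val); rewrite /= val_Zp_nat // modn_small //.
case: m => n m0; first by rewrite (nat_eq0 n) // => N /m0.
suff: n.+1 = 0%N by [].
apply: nat_eq0 => N /m0 /eqP.
by rewrite NegzE rmorphN oppr_eq0 => /eqP.
Qed.

Lemma free_residually_finite k (x : free_group k) :
  (forall N, (1 < N)%N -> sl2_rep k 'Z_N x = 1) -> x = 1.
Proof.
move=> x1; apply: sl2_rep_scalar.
have xE N : sl2_rep k 'Z_N x = sl2_map intr (sl2_rep k int x).
  apply: (@free_hom_ext _ _ (sl2_rep k 'Z_N) (sl2_map intr \o sl2_rep k int)) => i.
  rewrite /= !free_lift_gen; apply: val_inj => /=.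
  by rewrite !(rmorphD, rmorphN, rmorphM, rmorphB, rmorphXn, rmorph_nat, rmorph1).
have {}x1 N : (1 < N)%N -> sl2_map intr (sl2_rep k int x) = 1 :> sl2 'Z_N.
  by move=> N1; rewrite -xE x1.
move: x1; rewrite /= /sl2_map.
case: (sl2_rep k int x) => [[[[a b] c] d] /= h] x1.
have entries N : (1 < N)%N ->
    [/\ (b%:~R : 'Z_N)%R = 0%R, (c%:~R : 'Z_N)%R = 0%R
       & ((a - d)%:~R : 'Z_N)%R = 0%R].
  by move=> /x1 /(congr1 val) /= [a1 -> -> d1]; rewrite rmorphB /= a1 d1 subrr.
apply/and3P; split; first by apply/eqP/Zp_intr_eq0 => N /entries[].
  by apply/eqP/Zp_intr_eq0 => N /entries[].
by rewrite -subr_eq0; apply/eqP/Zp_intr_eq0 => N /entries[].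
Qed.

Section Precompose.
Variables (k l : nat) (psi : group_hom (free_group k) (free_group l)).
Hypothesis psi_surj : surjective psi.

(** Homomorphisms from a free group to [sl2 R] are encoded by the images of the generators, so that
    precomposition with [psi] becomes a map between finite sets. *)
Definition precompose (R : finComNzRingType) (h : {ffun 'I_l -> sl2 R}) :
    {ffun 'I_k -> sl2 R} :=
  [ffun i => free_lift h (psi (fgen i))].

Lemma precomposeE R h (x : free_group k) :
  free_lift (@precompose R h) x = free_lift h (psi x).
Proof.
apply: (@free_hom_ext _ _ (free_lift (precompose h)) (free_lift h \o psi)) => i.
by rewrite /= free_lift_gen ffunE.
Qed.

Lemma precompose_inj R : injective (@precompose R).
Proof.
move=> h h' hh'; apply/ffunP => j; have [y yj] := psi_surj (fgen j).
by rewrite -(free_lift_gen h) -(free_lift_gen h') -yj -!precomposeE hh'.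
Qed.

(** Counting homomorphisms to $SL_2(\mathbb{Z}/2)$ compares two powers of the order of a nontrivial
    finite group. *)
Lemma free_epi_rank : (l <= k)%N.
Proof.
have := leq_card _ (@precompose_inj 'Z_2); rewrite !card_ffun !card_ord.
rewrite leq_exp2l //; apply/card_gt1P; exists 1, (transvection 'Z_2).
by split=> //; rewrite eq_sym transvection_neq1.
Qed.

End Precompose.

(** Precomposition with [psi] is injective on a finite set, hence bijective, so each representation
    modulo $N$ factors through [psi]. The kernel of [psi] therefore dies modulo every $N$, and is
    trivial by residual finiteness. *)
Lemma free_hopfian k (psi : group_hom (free_group k) (free_group k)) :
  surjective psi -> bijective psi.
Proof.
move=> psi_surj; have psi_inj : injective psi.
  apply: gmulf_inj => x x1; apply: free_residually_finite => N N1.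
  have [g _ gK] := injF_bij (precompose_inj psi_surj (R := 'Z_N)).
  have := gK [ffun i : 'I_k => parabolic (i : nat)%:R%R].
  set h := g _ => hE.
  have <- : free_lift (precompose psi h) x = sl2_rep k 'Z_N x.
    apply: (@free_hom_ext _ _ (free_lift (precompose psi h)) (sl2_rep k 'Z_N)) => i.
    by rewrite /= !free_lift_gen hE ffunE.
  by rewrite precomposeE x1 gmulf1.
have [g gK] := choice psi_surj.
by exists g => // x; apply: psi_inj; rewrite gK.
Qed.

Lemma free_noncommutative k (i j : 'I_k) : i != j -> ~ commute (fgen i) (fgen j).
Proof.
move=> ij /(gmulf_commute (sl2_rep k int)); rewrite /= !free_lift_gen.
move=> /sl2_commute_proportional /= [_ _]; rewrite !natz => ji.
move/eqP: ij; apply; apply: val_inj; suff [] : Posz i = Posz j by [].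
by move: ji => /=; lra.
Qed.

End Hopf.

(** * Standard generators of pure braid groups *)

Section GroupWords.
Local Open Scope group_scope.
Variable G : groupType.
Implicit Types a b c g x y z : G.

Lemma commute_conj_fix x y : commute x y -> x ^ y = x.
Proof. by move=> xy; apply/conjg_fixP/commgP. Qed.

Lemma conjg_eq x y z : x * y = y * z -> x ^ y = z.
Proof. by move=> xy; rewrite /conjg xy mulKg. Qed.

Lemma commute_conj x y g : commute (x ^ g) (y ^ g) <-> commute x y.
Proof.
split=> [|xy]; last by rewrite /commute -!conjMg xy.
by rewrite /commute -!conjMg => /conjg_inj.
Qed.

Lemma commuteMl x y z : commute x z -> commute y z -> commute (x * y) z.
Proof. by move=> xz yz; apply/commute_sym/commuteM; apply/commute_sym. Qed.

Lemma commuteVl x y : commute x y -> commute x^-1 y.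
Proof. by move=> xy; apply/commute_sym/commuteV/commute_sym. Qed.

Lemma commuteJ x y z : commute x y -> commute x z -> commute x (y ^ z).
Proof. by move=> xy xz; apply: commuteM; [apply: commuteV | apply: commuteM]. Qed.

Inductive gen_by (S : G -> Prop) : G -> Prop :=
| gen_by_mem x : S x -> gen_by S x
| gen_by1 : gen_by S 1
| gen_byM x y : gen_by S x -> gen_by S y -> gen_by S (x * y)
| gen_byV x : gen_by S x -> gen_by S x^-1.

(** * Identities in the braid groups on three and four strands *)

Section BraidTriple.
Variables a b c : G.
Hypotheses (ab : a * b * a = b * a * b) (bc : b * c * b = c * b * c).
Hypothesis ac : commute a c.

Let aba z : a * (b * (a * z)) = b * (a * (b * z)).
Proof. by rewrite !mulgA ab. Qed.
Let bcb z : b * (c * (b * z)) = c * (b * (c * z)).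
Proof. by rewrite !mulgA bc. Qed.
Let acz z : a * (c * z) = c * (a * z).
Proof. by rewrite !mulgA ac. Qed.

Lemma braid_conjV : a ^ b = b ^ a^-1.
Proof. by apply: conjg_eq; rewrite conjgE invgK !mulgA -ab mulgK. Qed.

Lemma commute_loop2 : commute (b * a * a * b) a.
Proof.
suff E z : b * (a * (a * (b * (a * z)))) = a * (b * (a * (a * (b * z)))).
  by have := E 1; rewrite /commute -!mulgA !mulg1.
by rewrite [in RHS]aba [in LHS]aba.
Qed.

(** The element is the full twist on three strands: it is the square of [a * b * a], which exchanges
    [a] and [b] by conjugation. *)
Lemma commute_full3 : commute (b * a * a * b * (a * a)) a /\
  commute (b * a * a * b * (a * a)) b.
Proof.
have l2 := commute_loop2.
split; first by apply: commuteMl => //; apply: commuteMl.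
have -> : b * a * a * b * (a * a) = a * b * a * (a * b * a).
  rewrite (commuteM l2 l2) -!mulgA; congr (_ * _).
  rewrite !mulgA ab -!mulgA; congr (_ * (_ * _)).
  by rewrite !mulgA ab.
have ab1 : a * b * a * b = a * (a * b * a).
  by rewrite -!mulgA; congr (_ * _); rewrite !mulgA ab.
have ab2 : a * b * a * a = b * (a * b * a).
  by rewrite {1}ab -!mulgA; congr (_ * _); rewrite !mulgA ab.
by rewrite /commute -[LHS]mulgA ab1 [LHS]mulgA ab2 -[LHS]mulgA.
Qed.

(** The element carries the last of four strands once around the first three, whose crossings it
    leaves unchanged. *)
Lemma commute_loop3 : commute (c * b * a * a * b * c) a /\
  commute (c * b * a * a * b * c) b.
Proof.
split.
  suff E z : c * (b * (a * (a * (b * (c * (a * z)))))) =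
      a * (c * (b * (a * (a * (b * (c * z)))))).
    by have := E 1; rewrite /commute -!mulgA !mulg1.
  by rewrite -[in LHS]acz [in RHS]acz [in RHS]aba [in LHS]aba.
suff E z : c * (b * (a * (a * (b * (c * (b * z)))))) =
    b * (c * (b * (a * (a * (b * (c * z)))))).
  by have := E 1; rewrite /commute -!mulgA !mulg1.
by rewrite [in LHS]bcb [in RHS]bcb ![in LHS]acz.
Qed.

End BraidTriple.

(* In the Artin group of type B, with special generator t 0, the elements t i are
   the conjugates of t 0 that wind around a single strand. *)
Section ArtinB.
Variables (M : nat) (s t : nat -> G).
Hypothesis s_braid : forall i, i.+1 < M -> s i * s i.+1 * s i = s i.+1 * s i * s i.+1.
Hypothesis s_comm : forall i j, i.+1 < j -> commute (s i) (s j).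
Hypothesis t0_comm : forall j, 0 < j < M -> commute (t 0) (s j).
Hypothesis tS : forall i, i < M -> t i.+1 = t i ^ s i.

Lemma artinB_comm i j : i <= M -> j < M -> j != i -> j.+1 != i ->
  commute (t i) (s j).
Proof.
elim/ltn_ind: i j => -[|i] IHi j iM jM ji jSi; first by apply: t0_comm; lia.
rewrite tS //; have [ij|ji'] := leqP i j.
  apply/commute_sym/commuteJ; apply/commute_sym; first by apply: IHi; lia.
  by apply: s_comm; lia.
have [{jSi}jSi|jSi'] := eqVneq j.+1 i; last first.
  apply/commute_sym/commuteJ; first by apply/commute_sym/IHi; lia.
  by apply: s_comm; lia.
rewrite -jSi in iM IHi *; rewrite tS; last by lia.
(* Conjugation by [s j * s j.+1] carries [t j] to [t j.+2] and [s j.+1] to [s j], so the claim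
   reduces to the commutation of [t j] with [s j.+1]. *)
have sE : s j.+1 ^ (s j * s j.+1) = s j by apply: conjg_eq; rewrite !mulgA s_braid.
by rewrite -conjgM -[X in commute _ X]sE; apply/commute_conj/IHi; lia.
Qed.

(** The hypothesis is the relation of length four of type B. Conjugation by [s i.+1 * s i] raises by
    one the indices of [s i], [t i] and [t i.+1], which gives the induction step. *)
Lemma artinB_pair : commute (s 0) (t 1 * t 0) ->
  forall i, i < M -> commute (s i) (t i.+1 * t i).
Proof.
move=> s0; elim=> [//|i IHi] iM.
have sE : s i ^ (s i.+1 * s i) = s i.+1 by apply: conjg_eq; rewrite !mulgA s_braid.
have t1 : t i.+1 ^ (s i.+1 * s i) = t i.+2.
  rewrite conjgM -tS //; apply: commute_conj_fix; apply: artinB_comm; lia.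
have t0 : t i ^ (s i.+1 * s i) = t i.+1.
  have c : commute (t i) (s i.+1) by apply: artinB_comm; lia.
  by rewrite conjgM (commute_conj_fix c) tS //; lia.
have /(commute_conj _ _ (s i.+1 * s i)) : commute (s i) (t i.+1 * t i).
  by apply: IHi; lia.
by rewrite conjMg sE t1 t0.
Qed.

Lemma artinB_conjV i : i < M -> commute (s i) (t i.+1 * t i) ->
  t i ^ (s i)^-1 = (t i)^-1 * (t i.+1 * t i).
Proof.
move=> iM /commuteVl/commute_sym/commute_conj_fix.
by rewrite conjMg tS // conjgK => <-; rewrite mulKg.
Qed.

Lemma artinB_conj i : i < M -> commute (s i) (t i.+1 * t i) ->
  t i.+1 ^ s i = t i.+1 * t i * (t i.+1)^-1.
Proof.
move=> iM /commute_sym/commute_conj_fix.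
by rewrite conjMg -[t i ^ _]tS // => <-; rewrite mulgK.
Qed.

End ArtinB.

(** * Standard generators of the pure braid group and combing *)

Section Braid.
Variables (N : nat) (s : nat -> G).
Hypothesis s_braid : forall i, i.+1 < N -> s i * s i.+1 * s i = s i.+1 * s i * s i.+1.
Hypothesis s_comm : forall i j, i.+1 < j -> commute (s i) (s j).

Definition asc i m : G := \prod_(i <= j < m) s j.

(** This is the standard generator $A_{im}$, with the strands numbered from 0 to [N]. *)
Definition twist i m : G := (s i * s i) ^ asc i.+1 m.

Lemma asc_nil i m : m <= i -> asc i m = 1.
Proof. by move=> mi; rewrite /asc big_geq. Qed.

Lemma asc_recl i m : i < m -> asc i m = s i * asc i.+1 m.
Proof. by move=> im; rewrite /asc big_ltn. Qed.

Lemma asc_recr i m : i <= m -> asc i m.+1 = asc i m * s m.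
Proof. by move=> im; rewrite /asc big_nat_recr. Qed.

Lemma asc_cat i j m : i <= j -> j <= m -> asc i m = asc i j * asc j m.
Proof. by move=> ij jm; rewrite /asc (big_cat_nat ij jm). Qed.

Lemma s_comm_far i j : i.+1 < j \/ j.+1 < i -> commute (s i) (s j).
Proof. by case=> ij; [|apply: commute_sym]; apply: s_comm. Qed.

Lemma asc_commute x i m : (forall j, i <= j < m -> commute x (s j)) -> commute x (asc i m).
Proof.
move=> xs; rewrite /asc big_seq; apply: (big_ind (commute x)) => [|y z|j].
- exact: commute1.
- exact: commuteM.
- by rewrite mem_index_iota => /xs.
Qed.

Lemma asc_shift i j m : i <= j -> j.+1 < m -> m <= N ->
  s j.+1 * asc i m = asc i m * s j.
Proof.
move=> ij jm mN; rewrite (@asc_cat i j m) //; last by lia.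
rewrite (asc_recl (i := j)); last by lia.
rewrite (asc_recl (i := j.+1)); last by lia.
have c1 : commute (s j.+1) (asc i j) by apply: asc_commute => k ?; apply: s_comm_far; lia.
have c2 : commute (s j) (asc j.+2 m) by apply: asc_commute => k ?; apply: s_comm_far; lia.
rewrite !mulgA c1 -!mulgA; congr (_ * _).
by rewrite -c2 !mulgA s_braid //; lia.
Qed.

Lemma twist_diag i : twist i i.+1 = s i * s i.
Proof. by rewrite /twist asc_nil // conjg1. Qed.

Lemma twist_recr i m : i < m -> twist i m.+1 = twist i m ^ s m.
Proof. by move=> im; rewrite /twist asc_recr // conjgM. Qed.

Lemma twist_recl i m : i.+1 < m -> m <= N -> twist i.+1 m = twist i m ^ s i.
Proof.
move=> im mN; rewrite /twist (asc_recl im) conjgM -[RHS]conjgM.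
have c : commute (s i) (asc i.+2 m) by apply: asc_commute => k ?; apply: s_comm_far; lia.
rewrite -c conjgM; congr (_ ^ _); rewrite -conjgM.
rewrite !conjMg; have -> // : s i ^ (s i.+1 * s i) = s i.+1.
by apply: conjg_eq; rewrite !mulgA s_braid //; lia.
Qed.

Lemma twist_commute_high i m j : m < j -> i < m -> commute (twist i m) (s j).
Proof.
move=> mj im; apply/commute_sym/commuteJ; last first.
  by apply: asc_commute => k ?; apply: s_comm_far; lia.
by apply: commuteM; apply: s_comm_far; lia.
Qed.

Lemma twist_pair i m : i.+1 < m -> m <= N ->
  commute (s i) (twist i.+1 m * twist i m).
Proof.
move=> im mN; have c : commute (s i) (asc i.+2 m).
  by apply: asc_commute => k ?; apply: s_comm_far; lia.
rewrite /twist (asc_recl im) conjgM -conjMg; apply: commuteJ c.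
rewrite conjgE !mulgA mulgK.
by apply/commute_sym/commute_loop2; rewrite s_braid //; lia.
Qed.

Lemma twist_comm i m j : i < m -> m <= N -> j.+1 < m -> j != i -> j.+1 != i ->
  commute (twist i m) (s j).
Proof.
move=> im mN jm ji jSi.
apply: (@artinB_comm m.-1 s (fun i => twist i m)) => //; try lia.
- by move=> k km; apply: s_braid; lia.
(* Both [twist 0 m] and [s k] are conjugates by [asc 1 m], of [s 0 * s 0] and [s k.+1], which
   commute. *)
- move=> k km; have <- : s k.+1 ^ asc 1 m = s k.
    by apply: conjg_eq; rewrite asc_shift //; lia.
  by apply/commute_conj/commuteMl; apply: s_comm_far; lia.
- by move=> k km; rewrite twist_recl //; lia.
Qed.

Definition span m : G -> Prop := gen_by (fun y => exists2 j, j < m & y = s j).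

Definition twists m : G -> Prop := gen_by (fun y => exists2 i, i < m & y = twist i m).

Lemma span_gen m j : j < m -> span m (s j).
Proof. by move=> jm; apply: gen_by_mem; exists j. Qed.

Lemma span_asc i m m' : m <= m' -> span m' (asc i m).
Proof.
move=> mm; rewrite /asc big_seq; apply: (big_ind (span m')) => [|y z|j].
- exact: gen_by1.
- exact: gen_byM.
- by rewrite mem_index_iota => ?; apply: span_gen; lia.
Qed.

Lemma span_twist i m m' : i < m -> m <= m' -> span m' (twist i m).
Proof.
move=> im mm; have a := span_asc i.+1 mm; have i' : span m' (s i) by apply: span_gen; lia.
apply: gen_byM; first exact: gen_byV.
by do 2?apply: gen_byM.
Qed.

Lemma twists_gen i m : i < m -> twists m (twist i m).
Proof. by move=> im; apply: gen_by_mem; exists i. Qed.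

Lemma twists_conj_gen m j t : m <= N -> j.+1 < m -> twists m t ->
  twists m (t ^ s j) /\ twists m (t ^ (s j)^-1).
Proof.
move=> mN jm; elim=> {t} [t [i im ->]| |t u _ [t1 t2] _ [u1 u2]|t _ [t1 t2]].
- have [->|ji] := eqVneq i j.
    rewrite -twist_recl //; split; first exact: twists_gen.
    have -> : twist j m ^ (s j)^-1 = (twist j m)^-1 * (twist j.+1 m * twist j m).
      apply: (@artinB_conjV m.-1 s (fun i => twist i m)); last exact: twist_pair.
        by move=> k km; rewrite twist_recl //; lia.
      by lia.
    by apply: gen_byM; [apply: gen_byV|apply: gen_byM]; apply: twists_gen; lia.
  have [iE|jSi] := eqVneq i j.+1.
    rewrite iE; split; last by rewrite twist_recl // conjgK; apply: twists_gen; lia.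
    have -> : twist j.+1 m ^ s j = twist j.+1 m * twist j m * (twist j.+1 m)^-1.
      apply: (@artinB_conj m.-1 s (fun i => twist i m)); last exact: twist_pair.
        by move=> k km; rewrite twist_recl //; lia.
      by lia.
    by apply: gen_byM; [apply: gen_byM|apply: gen_byV]; apply: twists_gen; lia.
  have c : commute (twist i m) (s j) by apply: twist_comm; lia.
  rewrite (commute_conj_fix c) (commute_conj_fix (commuteV c)).
  by split; apply: twists_gen.
- by rewrite !conj1g; split; apply: gen_by1.
- by rewrite !conjMg; split; apply: gen_byM.
- by rewrite !conjVg; split; apply: gen_byV.
Qed.

Lemma twists_conj m g t : m <= N -> span m.-1 g -> twists m t ->
  twists m (t ^ g) /\ twists m (t ^ g^-1).
Proof.
move=> mN gm; elim: gm t => {g} [g [j jm ->] t tm| t tm|g h _ IHg _ IHh t tm|g _ IHg t tm].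
- by apply: twists_conj_gen; rewrite //; lia.
- by rewrite invg1 !conjg1.
- by rewrite invMg !conjgM; split; [apply: (IHh _ _).1; apply: (IHg _ _).1|
    apply: (IHg _ _).2; apply: (IHh _ _).2].
- by rewrite invgK; split; [apply: (IHg _ _).2 | apply: (IHg _ _).1].
Qed.

(** Here [asc x m] records which strand ends in position [m], [y] braids the lower strands, and [t]
    is a loop of strand [m] among them. *)
Definition combed m (w : G) : Prop := exists (x : nat) (y t : G),
  [/\ x <= m, span m.-1 y, twists m t & w = asc x m * y * t].

(** A letter either moves [x] by one, possibly leaving behind a twist that is carried past [y], or
    passes through [asc x m] and becomes a letter on the lower strands. *)
Lemma combed_letter m w i : m <= N -> i < m -> combed m w ->
  combed m (s i * w) /\ combed m ((s i)^-1 * w).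
Proof.
move=> mN im [x [y [t [xm ym tm ->]]]].
have tE k : (twist k m) = (asc k.+1 m)^-1 * (s k * s k * asc k.+1 m) by [].
have pass j : j < m.-1 -> s i * asc x m = asc x m * s j ->
    combed m (s i * (asc x m * y * t)) /\ combed m ((s i)^-1 * (asc x m * y * t)).
  move=> jm sE; split; exists x.
    exists (s j * y), t; split=> //; last by rewrite !mulgA sE.
    by apply: gen_byM => //; apply: span_gen.
  exists ((s j)^-1 * y), t; split=> //.
    by apply: gen_byM => //; apply: gen_byV; apply: span_gen.
  rewrite !mulgA; congr (_ * _ * _); apply: (mulgI (s i)).
  by rewrite mulVKg mulgA sE mulgK.
have [ix|xi] := ltnP i x.
  have [ix'|ix'] := eqVneq i.+1 x.
    subst x; split; first by exists i, y, t; split; rewrite ?(asc_recl im) ?mulgA //; lia.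
    exists i, y, ((twist i m)^-1 ^ y * t); split=> //; first by lia.
      by apply: gen_byM => //; apply: (twists_conj _ _ _).1 => //; apply/gen_byV/twists_gen.
    rewrite (asc_recl im) conjgE tE !invMg !mulgA mulgK; congr (_ * _ * _).
    by rewrite invgK mulgK mulgV mul1g.
  by apply: (pass i); [lia | apply: asc_commute => k ?; apply: s_comm_far; lia].
have [ix|ix] := eqVneq i x.
  subst x; split; last first.
    by exists i.+1, y, t; split; rewrite // (asc_recl im) -!mulgA mulKg.
  exists i.+1, y, ((twist i m) ^ y * t); split=> //.
    by apply: gen_byM => //; apply: (twists_conj _ _ _).1 => //; apply/twists_gen.
  by rewrite (asc_recl im) conjgE tE !mulgA mulgK mulgV mul1g.
apply: (pass i.-1); first by lia.
by have := @asc_shift x i.-1 m; rewrite prednK; [apply; lia | lia].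
Qed.

Lemma combed_span m w : m <= N -> span m w -> combed m w.
Proof.
move=> mN wm; have comb1 : combed m 1.
  exists m, 1, 1; rewrite asc_nil // !mulg1; split=> //; exact: gen_by1.
(* Acting on an arbitrary combed element, by [w] and its inverse at once, lets the induction pass
   through products and inverses. *)
suff H w' : combed m w' -> combed m (w * w') /\ combed m (w^-1 * w').
  by have [] := H _ comb1; rewrite mulg1.
elim: wm w' => {w} [w [j jm ->]|  |g h _ IHg _ IHh|g _ IHg] w' cw'.
- exact: combed_letter.
- by rewrite invg1 !mul1g.
- by rewrite invMg -!mulgA; split; [apply: (IHg _ _).1; apply: (IHh _ _).1|
    apply: (IHh _ _).2; apply: (IHg _ _).2].
- by rewrite invgK; split; [apply: (IHg _ _).2 | apply: (IHg _ _).1].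
Qed.

End Braid.

End GroupWords.

(** * Homomorphisms from pure braids to a group with commutative centralizers *)

Section PureHom.
Local Open Scope group_scope.
Variables (G F : groupType) (N : nat) (s : nat -> G).
Hypothesis s_braid : forall i, i.+1 < N -> s i * s i.+1 * s i = s i.+1 * s i * s i.+1.
Hypothesis s_comm : forall i j, i.+1 < j -> commute (s i) (s j).
Notation A := (twist s).

Let s_comm_far := s_comm_far s_comm.
Let asc_shift := asc_shift s_braid s_comm.
Let twist_recl := twist_recl s_braid s_comm.
Let twist_comm := twist_comm s_braid s_comm.
Let twist_commute_high := twist_commute_high s_comm.

Variable pure : G -> Prop.
Hypotheses (pure1 : pure 1) (pureM : forall x y, pure x -> pure y -> pure (x * y))
  (pureV : forall x, pure x -> pure x^-1) (pureJ : forall x g, pure x -> pure (x ^ g))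
  (pure_sq : forall i, pure (s i * s i)).
Hypothesis pure_ind : forall K : G -> Prop, K 1 ->
  (forall x y, K x -> K y -> K (x * y)) -> (forall x, K x -> K x^-1) ->
  (forall i m, i < m -> m <= N -> K (A i m)) -> forall x, pure x -> K x.
Hypothesis F_trans : forall x y z : F, y != 1 -> commute x y -> commute y z -> commute x z.

Lemma pure_twist i m : pure (A i m). Proof. exact: pureJ. Qed.

(** A homomorphism on the pure subgroup is represented by a function on all of [G], so that it can
    be precomposed with conjugation by any braid. *)
Definition pure_hom (H : groupType) (h : G -> H) : Prop :=
  forall x y, pure x -> pure y -> h (x * y) = h x * h y.

Lemma pure_hom1 (H : groupType) (h : G -> H) : pure_hom h -> h 1 = 1.
Proof. by move=> hM; apply: (mulgI (h 1)); rewrite -hM // !mulg1. Qed.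

Lemma pure_homV (H : groupType) (h : G -> H) x : pure_hom h -> pure x -> h x^-1 = (h x)^-1.
Proof.
move=> hM px; apply: (mulgI (h x)); rewrite -hM //; last exact: pureV.
by rewrite !mulgV pure_hom1.
Qed.

Lemma pure_hom3 (H : groupType) (h : G -> H) x y z : pure_hom h ->
  pure x -> pure y -> pure z -> h (x * y * z) = h x * h y * h z.
Proof. by move=> hM *; rewrite !hM //; apply: pureM. Qed.

Lemma pure_hom_commute (H : groupType) (h : G -> H) x y : pure_hom h -> pure x -> pure y ->
  commute x y -> commute (h x) (h y).
Proof. by move=> hM px py xy; rewrite /commute -!hM // xy. Qed.

Lemma pure_hom_conj (H : groupType) (h : G -> H) g : pure_hom h -> pure_hom (fun x => h (x ^ g)).
Proof. by move=> hM x y px py; rewrite conjMg hM //; apply: pureJ. Qed.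

(** * If adjacent twists always commute in the image, the image is abelian *)

Section Crossing.
Variable h : G -> F.
Hypothesis hM : pure_hom h.

(** Quantifying over all braids [g], pure or not, makes the relation invariant under simultaneous
    conjugation, so that it can be transported between configurations of strands. *)
Definition commuting x y : Prop := forall g, commute (h (x ^ g)) (h (y ^ g)).

Lemma commuting_sym x y : commuting x y -> commuting y x.
Proof. by move=> xy g; apply: commute_sym. Qed.

Lemma commuting_conj x y g : commuting (x ^ g) (y ^ g) <-> commuting x y.
Proof.
split=> xy k; first by have := xy (g^-1 * k); rewrite -!conjgM !mulVKg.
by rewrite -!conjgM.
Qed.

Lemma commute_commuting x y : pure x -> pure y -> commute x y -> commuting x y.
Proof.
move=> px py xy g; apply: pure_hom_commute => //; try exact: pureJ.
by apply/commute_conj.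
Qed.

Lemma commuting_conj_gen x y x' y' j : x ^ s j = x' -> y ^ s j = y' ->
  commuting x y <-> commuting x' y'.
Proof.
by move=> <- <-; exact: iff_sym (commuting_conj x y (s j)).
Qed.

Lemma twist_fix i m j : i < m -> m <= N -> j != i -> j.+1 != i -> j.+1 < m \/ m < j ->
  A i m ^ s j = A i m.
Proof.
move=> im mN ji jSi jm; apply: commute_conj_fix.
by case: jm => jm; [apply: twist_comm | apply: twist_commute_high].
Qed.

Lemma sq_fix i j : i.+1 < j \/ j.+1 < i -> (s i * s i) ^ s j = s i * s i.
Proof.
by move=> ij; apply/commute_conj_fix/commuteMl; apply: s_comm_far.
Qed.

Lemma gen_shift j : j.+1 < N -> s j.+1 ^ asc s 0 N = s j.
Proof. by move=> jN; apply: conjg_eq; rewrite asc_shift. Qed.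

Hypothesis adjacent0 : commuting (s 0 * s 0) (s 1 * s 1).

Lemma commuting_adjacent i : i.+1 < N -> commuting (s i * s i) (s i.+1 * s i.+1).
Proof.
elim: i => [//|i IHi] iN; apply/(commuting_conj _ _ (asc s 0 N)).
by rewrite !conjMg !gen_shift //; [apply: IHi|]; lia.
Qed.

Lemma commuting_chain0 i k : i < k -> k < N -> commuting (A i k) (s k * s k).
Proof.
move=> ik kN; have [d dE] : exists d, i + d.+1 = k by exists (k - i.+1); lia.
elim: d i ik dE => [|d IHd] i ik dE.
  have kE : k = i.+1 by lia.
  by rewrite kE twist_diag; apply: commuting_adjacent; lia.
apply/(@commuting_conj_gen _ _ (A i.+1 k) (s k * s k) i); last by apply: IHd; lia.
  by rewrite -twist_recl //; lia.
by apply: sq_fix; lia.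
Qed.

Lemma commuting_chain i k l : i < k -> k < l -> l <= N -> commuting (A i k) (A k l).
Proof.
move=> ik; elim: l => [//|l IHl] kl lN.
have [->|kl'] := eqVneq k l; first by rewrite twist_diag; apply: commuting_chain0; lia.
apply/(@commuting_conj_gen (A i k) (A k l) _ _ l); last by apply: IHl; lia.
  by apply: twist_fix; lia.
by rewrite twist_recr //; lia.
Qed.

Lemma commuting_left0 i j : i < j -> j < N -> commuting (A i j) (A i j.+1).
Proof.
move=> ij jN; have [d dE] : exists d, i + d.+1 = j by exists (j - i.+1); lia.
elim: d i ij dE => [|d IHd] i ij dE.
  have jE : j = i.+1 by lia.
  (* The twist [A i i.+2] is also the conjugate of [s i.+1 * s i.+1] by the inverse of [s i];
     conjugating back by [s i] fixes [s i * s i] and leaves an adjacent pair. *)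
  rewrite jE in jN *; rewrite (@twist_recr _ _ i i.+1) // twist_diag conjMg braid_conjV ?s_braid //.
  apply/(@commuting_conj_gen _ _ (s i * s i) (s i.+1 * s i.+1) i).
  - by rewrite conjMg (commute_conj_fix (commute_refl _)).
  - by rewrite -conjMg conjgKV.
  - by apply: commuting_adjacent.
apply/(@commuting_conj_gen _ _ (A i.+1 j) (A i.+1 j.+1) i); last by apply: IHd; lia.
  by rewrite -twist_recl //; lia.
by rewrite -twist_recl //; lia.
Qed.

Lemma commuting_left i j l : i < j -> j < l -> l <= N -> commuting (A i j) (A i l).
Proof.
move=> ij; elim: l => [//|l IHl] jl lN.
have [<-|jl'] := eqVneq j l; first by apply: commuting_left0; lia.
apply/(@commuting_conj_gen (A i j) (A i l) _ _ l); last by apply: IHl; lia.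
  by apply: twist_fix; lia.
by rewrite twist_recr //; lia.
Qed.

Lemma commuting_right i k m : i < k -> k < m -> m <= N -> commuting (A i m) (A k m).
Proof.
move=> ik; elim: m => [//|m IHm] km mN.
have [<-|km'] := eqVneq k m.
  apply/(@commuting_conj_gen (A i k) (s k * s k) _ _ k).
  - by rewrite twist_recr.
  - by rewrite twist_diag conjMg (commute_conj_fix (commute_refl _)).
  - by apply: commuting_chain0; lia.
apply/(@commuting_conj_gen (A i m) (A k m) _ _ m); last by apply: IHm; lia.
  by rewrite twist_recr //; lia.
by rewrite twist_recr //; lia.
Qed.

Lemma commute_nested i j k l : k < i -> i < j -> j < l -> l <= N ->
  commute (A i j) (A k l).
Proof.
move=> ki ij jl lN; apply/commute_sym.
have c t : i <= t < j -> commute (A k l) (s t) by move=> ?; apply: twist_comm; lia.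
apply: commuteJ; first by apply: commuteM; apply: c; lia.
by apply: asc_commute => t ?; apply: c; lia.
Qed.

Lemma commute_disjoint i j k l : i < j -> j < k -> k < l -> commute (A i j) (A k l).
Proof.
move=> ij jk kl; have c t : k <= t -> commute (A i j) (s t).
  by move=> ?; apply: twist_commute_high; lia.
apply: commuteJ; first by apply: commuteM; apply: c; lia.
by apply: asc_commute => t ?; apply: c; lia.
Qed.

(** The product is the full twist on strands [i] to [i.+3], the product of the loops of these
    strands around their predecessors. *)
Lemma full_twist4 i : i.+2 < N ->
  commute (A i i.+1 * A i.+1 i.+2 * A i i.+2 * A i.+2 i.+3 * A i.+1 i.+3 * A i i.+3)
    (A i i.+2).
Proof.
move=> iN; have i2 : i < i.+2 by lia.
rewrite (twist_recr s i2) (twist_recr s (ltnSn i)) (twist_recr s (ltnSn i.+1)).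
rewrite !twist_diag.
have := @s_braid i; have := @s_braid i.+1; have := s_comm (ltnSn i.+1).
move: (s i) (s i.+1) (s i.+2) => a b c ac bc ab.
have {}ab : a * b * a = b * a * b by apply: ab; lia.
have {}bc : b * c * b = c * b * c by apply: bc; lia.
set Z := (X in commute X _).
have c2 := commute_loop2 ab.
have -> : Z = (b * a * a * b) * (a * a) * (c * b * a * a * b * c).
  by rewrite (commuteM c2 c2) /Z !conjgE -!mulgA !(mulVKg, mulKg).
have [c3a c3b] := commute_loop3 ab bc ac; have [fa fb] := commute_full3 ab.
by apply: commuteJ; [apply: commuteM|]; apply: commuteMl.
Qed.

(** Each of the other four twists on these strands shares a strand with both crossing ones, so its
    image commutes with both images. If those two do not commute, the four are trivial by
    transitivity, the full twist maps to the product of the two, and its centrality makes them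
    commute after all. *)
Lemma commuting_crossing0 i : i.+2 < N -> commuting (A i i.+2) (A i.+1 i.+3).
Proof.
move=> iN g; have iN' : i.+3 <= N by lia.
pose k x := h (x ^ g).
have kM : pure_hom k by exact: pure_hom_conj.
have trivial x : commuting x (A i i.+2) -> commuting x (A i.+1 i.+3) ->
    k x = 1 \/ commute (k (A i i.+2)) (k (A i.+1 i.+3)).
  move=> x1 x2; have [?|x0] := eqVneq (k x) 1; [by left | right].
  exact: F_trans x0 (commute_sym (x1 g)) (x2 g).
have [||e1|//] := trivial (A i i.+1).
- by apply: commuting_left; lia.
- by apply: commuting_chain; lia.
have [||e2|//] := trivial (A i.+1 i.+2).
- by apply: commuting_sym; apply: commuting_right; lia.
- by apply: commuting_left; lia.
have [||e3|//] := trivial (A i.+2 i.+3).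
- by apply: commuting_sym; apply: commuting_chain; lia.
- by apply: commuting_sym; apply: commuting_right; lia.
have [||e4|//] := trivial (A i i.+3).
- by apply: commuting_sym; apply: commuting_left; lia.
- by apply: commuting_right; lia.
have := pure_hom_commute kM _ (pure_twist i i.+2) (full_twist4 iN).
have -> : k (A i i.+1 * A i.+1 i.+2 * A i i.+2 * A i.+2 i.+3 * A i.+1 i.+3 * A i i.+3)
    = k (A i i.+2) * k (A i.+1 i.+3).
  have kM6 a b c d e f : pure a -> pure b -> pure c -> pure d -> pure e -> pure f ->
      k (a * b * c * d * e * f) = k a * k b * k c * k d * k e * k f.
    by move=> *; rewrite !kM; do ?apply: pureM.
  by rewrite kM6; do ?exact: pure_twist; rewrite e1 e2 e3 e4 !mul1g !mulg1.
have pZ : pure (A i i.+1 * A i.+1 i.+2 * A i i.+2 * A i.+2 i.+3 * A i.+1 i.+3 * A i i.+3).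
  by do ?[exact: pure_twist | exact: pure_sq | apply: pureM].
by move=> /(_ pZ); rewrite /commute -mulgA => /mulgI.
Qed.

Lemma commuting_crossing1 i j : i.+1 < j -> j < N -> commuting (A i j) (A i.+1 j.+1).
Proof.
elim: j => [//|j IHj] ij jN.
have [jE|jE] := eqVneq j i.+1; first by rewrite jE; apply: commuting_crossing0; lia.
apply/(@commuting_conj_gen (A i j) (A i.+1 j.+2) _ _ j).
- by rewrite twist_recr //; lia.
- by apply: twist_fix; lia.
apply/(@commuting_conj_gen (A i j) (A i.+1 j.+1) _ _ j.+1).
- by apply: twist_fix; lia.
- by rewrite [RHS]twist_recr //; lia.
by apply: IHj; lia.
Qed.

Lemma commuting_crossing2 i k j : i < k -> k < j -> j < N -> commuting (A i j) (A k j.+1).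
Proof.
move=> ik kj jN; have [d dE] : exists d, i + d.+1 = k by exists (k - i.+1); lia.
elim: d i ik dE => [|d IHd] i ik dE.
  by have kE : k = i.+1 by [lia]; rewrite kE in kj *; apply: commuting_crossing1; lia.
apply/(@commuting_conj_gen _ _ (A i.+1 j) (A k j.+1) i); last by apply: IHd; lia.
  by rewrite -twist_recl //; lia.
by apply: twist_fix; lia.
Qed.

Lemma commuting_crossing i k j l : i < k -> k < j -> j < l -> l <= N ->
  commuting (A i j) (A k l).
Proof.
move=> ik kj; elim: l => [//|l IHl] jl lN.
have [<-|jl'] := eqVneq j l; first by apply: commuting_crossing2; lia.
apply/(@commuting_conj_gen (A i j) (A k l) _ _ l); last by apply: IHl; lia.
  by apply: twist_fix; lia.
by rewrite twist_recr //; lia.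
Qed.

Lemma commuting_twists i j k l : i < j -> j <= N -> k < l -> l <= N -> commuting (A i j) (A k l).
Proof.
move=> ij jN kl lN.
wlog jl : i j k l ij jN kl lN / j <= l.
  move=> H; have [jl|lj] := leqP j l; first exact: H.
  by apply: commuting_sym; apply: H => //; lia.
have [jE|jl'] := eqVneq j l.
  subst l; have [ik|ki|->] := ltngtP i k; last by move=> g.
    by apply: commuting_right.
  by apply: commuting_sym; apply: commuting_right.
have [ik|ki|ik] := ltngtP i k.
- have [kj|jk|<-] := ltngtP k j; last by apply: commuting_chain; lia.
    by apply: commuting_crossing; lia.
  by apply: commute_commuting; [exact: pure_twist..|apply: commute_disjoint; lia].
- by apply: commute_commuting; [exact: pure_twist..|apply: commute_nested; lia].
- by subst k; apply: commuting_left; lia.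
Qed.

Lemma commuting_abelian x y : pure x -> pure y -> commute (h x) (h y).
Proof.
have gen i j : i < j -> j <= N -> forall z, pure z -> pure z /\ commute (h (A i j)) (h z).
  move=> ij jN; apply: pure_ind.
  - by split=> //; rewrite pure_hom1 //; apply: commute1.
  - move=> a b [pa ca] [pb cb]; split; first exact: pureM.
    by rewrite hM //; apply: commuteM.
  - move=> a [pa ca]; split; first exact: pureV.
    by rewrite pure_homV //; apply: commuteV.
  - move=> k l kl lN; split; first exact: pure_twist.
    by have := commuting_twists ij jN kl lN 1; rewrite !conjg1.
move=> px py; suff [//] : pure x /\ commute (h x) (h y).
move: x px; apply: pure_ind.
- by split=> //; rewrite pure_hom1 //; apply/commute_sym/commute1.
- move=> a b [pa ca] [pb cb]; split; first exact: pureM.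
  by rewrite hM //; apply: commuteMl.
- move=> a [pa ca]; split; first exact: pureV.
  by rewrite pure_homV //; apply: commuteVl.
- move=> k l kl lN; split; first exact: pure_twist.
  by have [] := gen k l kl lN y py.
Qed.

End Crossing.

Definition noncommuting (h : G -> F) : Prop := ~ commute (h (s 0 * s 0)) (h (s 1 * s 1)).

Lemma exists_noncommuting h x y : pure_hom h -> pure x -> pure y -> ~ commute (h x) (h y) ->
  exists g, noncommuting (fun z => h (z ^ g)).
Proof.
move=> hM px py nxy; apply: contrapT => H; apply: nxy; apply: commuting_abelian => // g.
by apply: contrapT => nc; apply: H; exists g.
Qed.

Hypothesis N2 : 2 <= N.

(** * Relations forced when the images of $A_{01}$ and $A_{12}$ do not commute *)

Section Noncommuting.
Variable h : G -> F.
Hypotheses (hM : pure_hom h) (h_nc : noncommuting h).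

Lemma noncommuting_eq1 z : commute z (h (s 0 * s 0)) -> commute z (h (s 1 * s 1)) -> z = 1.
Proof.
move=> z0 z1; apply: contrapT => /eqP z_neq1; apply: h_nc.
exact: F_trans z_neq1 (commute_sym z0) z1.
Qed.

Lemma kill x : pure x -> commute x (s 0) -> commute x (s 1) -> h x = 1.
Proof.
by move=> px x0 x1; apply: noncommuting_eq1; apply: pure_hom_commute => //; apply: commuteM.
Qed.

Lemma twist02 : A 0 2 = (s 0 * s 0) ^ s 1.
Proof. by rewrite twist_recr // twist_diag. Qed.

(** The product is the full twist on strands 0, 1, 2, which [kill] applies to. Hence any two of the
    three images determine the third. *)
Lemma h_triple : h (s 1 * s 1) * h (A 0 2) * h (s 0 * s 0) = 1.
Proof.
have pZ : pure (s 1 * s 1 * A 0 2 * (s 0 * s 0)).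
  by do ?[exact: pure_twist | exact: pure_sq | apply: pureM].
have <- : h (s 1 * s 1 * A 0 2 * (s 0 * s 0)) = h (s 1 * s 1) * h (A 0 2) * h (s 0 * s 0).
  exact: (pure_hom3 hM (pure_sq 1) (pure_twist 0 2) (pure_sq 0)).
have ab : s 0 * s 1 * s 0 = s 1 * s 0 * s 1 by apply: s_braid.
have [fa fb] := commute_full3 ab; move: pZ; rewrite twist02.
have -> : s 1 * s 1 * ((s 0 * s 0) ^ s 1) * (s 0 * s 0) = s 1 * s 0 * s 0 * s 1 * (s 0 * s 0).
  by rewrite conjgE -!mulgA mulVKg.
by move=> pZ; apply: kill.
Qed.

Lemma commute_02_1 z : commute z (h (A 0 2)) -> commute z (h (s 1 * s 1)) -> z = 1.
Proof.
move=> z02 z1; apply: noncommuting_eq1 => //.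
by rewrite -(mulg1_eq h_triple); apply/commuteV/commuteM.
Qed.

Lemma commute_02_0 z : commute z (h (A 0 2)) -> commute z (h (s 0 * s 0)) -> z = 1.
Proof.
move=> z02 z0; apply: noncommuting_eq1 => //.
have : h (s 1 * s 1) = (h (A 0 2) * h (s 0 * s 0))^-1.
  by apply/esym/mulg1_eq; apply: (mulgI (h (s 1 * s 1))); rewrite !mulgA h_triple mul1g mulg1.
by move=> ->; apply/commuteV/commuteM.
Qed.

Hypothesis N3 : 3 <= N.

(** This conjugate of [A 1 3] links strands 1 and 3 on the other side of strand 2. It commutes with
    [A 0 2], as both arise by conjugation with [s 1] from the commuting squares of [s 2] and
    [s 0]. *)
Let z13 := (s 2 * s 2) ^ s 1.

Lemma z13E : z13 = A 1 3 ^ (s 2 * s 2)^-1.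
Proof.
rewrite /z13 conjMg braid_conjV; last by rewrite s_braid.
by rewrite -conjMg twist_recr // twist_diag -conjgM invMg mulKVg.
Qed.

Lemma pure_z13 : pure z13.
Proof. by apply: pureJ. Qed.

(** The product is the loop of strand 3 around strands 0, 1, 2, which commutes with [s 0] and
    [s 1]. *)
Lemma h_triple3 : h z13 * h (s 2 * s 2) * h (A 0 3) = 1.
Proof.
have pZ : pure (z13 * (s 2 * s 2) * A 0 3).
  by do ?[exact: pure_twist | exact: pure_sq | exact: pure_z13 | apply: pureM].
have <- : h (z13 * (s 2 * s 2) * A 0 3) = h z13 * h (s 2 * s 2) * h (A 0 3).
  exact: (pure_hom3 hM pure_z13 (pure_sq 2) (pure_twist 0 3)).
have ab : s 0 * s 1 * s 0 = s 1 * s 0 * s 1 by apply: s_braid.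
have bc : s 1 * s 2 * s 1 = s 2 * s 1 * s 2 by apply: s_braid.
have [fa fb] := commute_loop3 ab bc (s_comm (ltnSn 1)).
suff E : z13 * (s 2 * s 2) * A 0 3 = s 2 * s 1 * s 0 * s 0 * s 1 * s 2.
  by rewrite E in pZ *; apply: kill.
rewrite /z13 conjMg braid_conjV // -conjMg twist_recr // twist02 !conjgE invgK -!mulgA.
by rewrite !(mulVKg, mulKg).
Qed.

(** The images of [z13] and [A 0 3] become mutually inverse. One commutes with the image of [A 0 2]
    and the other with that of [A 1 2], so both are trivial. *)
Lemma twist23_03 : h (A 2 3) = 1 -> h (A 0 3) = 1 /\ h (A 1 3) = 1.
Proof.
rewrite twist_diag => h2; have := h_triple3; rewrite h2 mulg1 => zx.
have z1 : h z13 = 1.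
  apply: commute_02_1.
    apply: pure_hom_commute => //; [exact: pure_z13 | exact: pure_twist |].
    rewrite twist02; apply/commute_conj.
    by apply: commuteM; apply: commuteMl; apply: s_comm_far; right.
  rewrite -[h z13]invgK (mulg1_eq zx); apply: commuteVl.
  apply: pure_hom_commute => //; first exact: pure_twist.
  by apply: commuteM; apply: twist_comm.
split; first by move: zx; rewrite z1 mul1g.
have := z1; rewrite z13E conjgE invgK mulgA.
rewrite (pure_hom3 hM (pure_sq 2) (pure_twist 1 3) (pureV (pure_sq 2))).
by rewrite pure_homV // h2 invg1 mul1g mulg1.
Qed.

Lemma twist03_23 : h (A 0 3) = 1 -> h (A 2 3) = 1.
Proof.
move=> h0; have := h_triple3; rewrite h0 mulg1 => zy.
rewrite twist_diag; apply: commute_02_0.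
  rewrite -(mulg1_eq zy); apply: commuteVl.
  apply: pure_hom_commute => //; [exact: pure_z13 | exact: pure_twist |].
  rewrite twist02; apply/commute_conj.
  by apply: commuteM; apply: commuteMl; apply: s_comm_far; right.
apply: pure_hom_commute => //.
by apply: commuteM; apply: commuteMl; apply: s_comm_far; right.
Qed.

End Noncommuting.

Lemma noncommuting_conj h g : commute (s 0) g -> commute (s 1) g ->
  noncommuting h -> noncommuting (fun x => h (x ^ g)).
Proof.
by rewrite /noncommuting => g0 g1; rewrite !conjMg (commute_conj_fix g0) (commute_conj_fix g1).
Qed.

Lemma commute_asc_high i j m : i.+1 < j -> commute (s i) (asc s j m).
Proof. by move=> ij; apply: asc_commute => k ?; apply: s_comm_far; lia. Qed.

Lemma twist_asc i k m : i < k -> k <= m -> A i m = A i k ^ asc s k m.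
Proof. by move=> ik km; rewrite /twist -conjgM -asc_cat. Qed.

(** * Homomorphisms that kill every twist outside the strands 0, 1, 2 *)

Section Types.
Variable h : G -> F.
Hypotheses (hM : pure_hom h) (h_nc : noncommuting h).

(** Conjugation by [asc s 3 k] fixes [s 0] and [s 1] and moves strand 3 to position [k], which
    reduces the claim to the case $k=3$. *)
Lemma twist2_eq1 k : 3 <= k -> k <= N -> h (A 2 k) = 1 -> h (A 0 k) = 1 /\ h (A 1 k) = 1.
Proof.
move=> k3 kN; rewrite !(@twist_asc _ 3 k) //.
have nc : noncommuting (fun x => h (x ^ asc s 3 k)).
  by apply: noncommuting_conj => //; apply: commute_asc_high.
by apply: (twist23_03 (pure_hom_conj _ hM) nc); lia.
Qed.

Lemma twist0_eq1 k : 3 <= k -> k <= N -> h (A 0 k) = 1 -> h (A 2 k) = 1.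
Proof.
move=> k3 kN; rewrite !(@twist_asc _ 3 k) //.
have nc : noncommuting (fun x => h (x ^ asc s 3 k)).
  by apply: noncommuting_conj => //; apply: commute_asc_high.
by apply: (twist03_23 (pure_hom_conj _ hM) nc); lia.
Qed.

Lemma twist2_commute0 k : 3 <= k -> k <= N -> commute (A 2 k) (s 0 * s 0).
Proof. by move=> k3 kN; apply: commuteM; apply: twist_comm; lia. Qed.

Lemma twist0_commute1 k : 3 <= k -> k <= N -> commute (A 0 k) (s 1 * s 1).
Proof. by move=> k3 kN; apply: commuteM; apply: twist_comm; lia. Qed.

Definition trivial_type : Prop := forall k, 3 <= k -> k <= N -> h (A 2 k) = 1.

Lemma trivial_type_high i k : trivial_type -> i < k -> 3 <= k -> k <= N -> h (A i k) = 1.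
Proof.
move=> ht ik k3 kN; have [h0 h1] := twist2_eq1 k3 kN (ht k k3 kN).
case: i ik => [//|[//|[|i]]] ik; first exact: ht.
have c j : j < 2 -> commute (A i.+3 k) (s j) by move=> j2; apply: twist_comm; lia.
by apply: (kill hM h_nc); [exact: pure_twist | exact: c | exact: c].
Qed.

End Types.

(** On the twists with [k] at least 3 both maps are trivial, and [h_triple] recovers the value at
    [A 0 2] from the two given ones. *)
Lemma trivial_type_ext h h' : pure_hom h -> noncommuting h -> trivial_type h ->
  pure_hom h' -> noncommuting h' -> trivial_type h' ->
  h (s 0 * s 0) = h' (s 0 * s 0) -> h (s 1 * s 1) = h' (s 1 * s 1) ->
  forall x, pure x -> h x = h' x.
Proof.
move=> hM h_nc ht hM' h_nc' ht' e0 e1 x px.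
suff [] : pure x /\ h x = h' x by [].
move: x px; apply: pure_ind.
- by split; rewrite // !pure_hom1.
- by move=> x y [px hx] [py hy]; split; [exact: pureM | rewrite hM // hM' // hx hy].
- by move=> x [px hx]; split; [exact: pureV | rewrite !pure_homV // hx].
move=> i k ik kN; split; first exact: pure_twist.
have [k3|k3] := leqP 3 k; first by rewrite !trivial_type_high.
case: k k3 ik kN => [//|[|[|//]]] _; case: i => [|[|//]] // _ _.
- by rewrite !twist_diag.
- apply: (mulgI (h (s 1 * s 1))); apply: (mulIg (h (s 0 * s 0))).
  by rewrite (h_triple hM) // e0 e1 (h_triple hM').
- by rewrite !twist_diag.
Qed.

(** * Exchanging the last strand with the boundary *)

Variable I : G -> G.
Hypotheses (IM : pure_hom I) (I_pure : forall x, pure x -> pure (I x)).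
Hypotheses (I0 : I (s 0 * s 0) = (s 0 * s 0)^-1) (I1 : 3 <= N -> I (s 1 * s 1) = (s 1 * s 1)^-1).
Hypothesis I2 : forall k x, 3 <= k -> k < N ->
  (forall j, 2 <= j < k -> commute x (s j)) -> commute x (I (A 2 k)).
Hypothesis I_top : forall j, 1 <= j < N -> commute (I (A 0 N)) (s j).

Lemma trivial_type_flip h : 3 <= N -> pure_hom h -> noncommuting h -> h (A 2 N) != 1 ->
  noncommuting (h \o I) /\ trivial_type (h \o I).
Proof.
move=> N3 hM h_nc hN.
have hIM : pure_hom (h \o I).
  by move=> x y px py /=; rewrite IM // hM //; apply: I_pure.
have hI_nc : noncommuting (h \o I).
  rewrite /noncommuting /= I0 I1 // !pure_homV // => /commuteV; rewrite invgK.
  by move=> /commuteVl; rewrite invgK.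
split=> // k k3 kN; have hN0 : h (A 0 N) != 1.
  by apply: contra hN => /eqP hN; apply/eqP/twist0_eq1.
have pA := pure_twist; have N3' := leqnn N.
(* For $k=N$, [I (A 0 N)] commutes with [A 2 N], whose nontrivial image commutes with that of
   [s 0 * s 0]; it also commutes with [s 1 * s 1], so its image is trivial, and [twist0_eq1] passes
   on to [A 2 N]. *)
have [->|kN'] := eqVneq k N.
  apply: twist0_eq1 => //=.
  apply: (noncommuting_eq1 h_nc); last first.
    apply: pure_hom_commute => //; first exact: I_pure.
    by apply: commuteM; apply: I_top; lia.
  have c : commute (I (A 0 N)) (A 2 N).
    apply: commuteJ; last by apply: asc_commute => j ?; apply: I_top; lia.
    by apply: commuteM; apply: I_top; lia.
  apply: (F_trans hN); first by apply: pure_hom_commute => //; exact: I_pure.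
  by apply: pure_hom_commute => //; apply: twist2_commute0.
(* For $k<N$, [I (A 2 k)] commutes with [I (s 0 * s 0)], the inverse of [s 0 * s 0], and with
   [A 0 N], whose nontrivial image commutes with that of [s 1 * s 1]. *)
have kN1 : k < N by lia.
have pI : pure (I (A 2 k)) by exact: I_pure.
rewrite /=.
apply: (noncommuting_eq1 h_nc).
  have := pure_hom_commute hIM (pA 2 k) (pure_sq 0) (twist2_commute0 k3 kN).
  by rewrite /= I0 pure_homV // => /commuteV; rewrite invgK.
apply: (F_trans hN0); last first.
  by apply: pure_hom_commute => //; apply: twist0_commute1.
apply: pure_hom_commute => //; apply/commute_sym/I2 => // j ?.
by apply: twist_comm; lia.
Qed.

Lemma exists_trivial_type h x y : pure_hom h -> pure x -> pure y -> ~ commute (h x) (h y) ->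
  exists (g : G) (b : bool), let h' := fun z => h ((if b then I z else z) ^ g) in
    noncommuting h' /\ trivial_type h'.
Proof.
move=> hM px py nxy; have [g0 nc0] := exists_noncommuting hM px py nxy.
have hM0 := pure_hom_conj g0 hM; set h0 := fun z => _ in nc0 hM0.
have [ht|] := pselect (trivial_type h0); first by exists g0, false.
move=> /existsNP [k] /not_implyP [k3] /not_implyP [kN] /eqP hk.
(* Conjugation by [g1] turns [A 2 N] into [A 2 k], so the surviving strand becomes the last one, as
   [trivial_type_flip] requires. *)
pose g1 := (asc s k N)^-1; have N3 : 3 <= N by lia.
have c j : j < 2 -> commute (s j) g1.
  by move=> j2; apply: commuteV; apply: commute_asc_high; lia.
have hM1 := pure_hom_conj g1 hM0; have nc1 := noncommuting_conj (c 0%N isT) (c 1%N isT) nc0.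
have [nc tr] : noncommuting ((fun z => h0 (z ^ g1)) \o I) /\
    trivial_type ((fun z => h0 (z ^ g1)) \o I).
  apply: trivial_type_flip => //.
  by rewrite (@twist_asc 2 k N) ?conjgK //; lia.
exists (g1 * g0), true; rewrite /=.
have -> : (fun z => h (I z ^ (g1 * g0))) = (fun z => h0 (z ^ g1)) \o I.
  by apply/funext => z /=; rewrite /h0 conjgM.
by split.
Qed.

End PureHom.

(** * The braid group and the projection to three strands *)

Section Cocycle.
Local Open Scope group_scope.
Variables (I : choiceType) (R : word I -> word I -> Prop) (X : Type) (V : X -> Prop).
Variables (G : groupType) (act : I -> X -> X) (c : I -> X -> G).
Hypothesis actK : forall i, involutive (act i).
Hypothesis actV : forall i x, V x -> V (act i x).

Fixpoint walk (w : word I) (x : X) : X :=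
  if w is a :: w' then walk w' (act a.1 x) else x.

(** An inverse letter read at [x] undoes the generator read at [act a.1 x], hence its value. *)
Fixpoint cocycle (w : word I) (x : X) : G :=
  if w is a :: w' then
    (if a.2 then (c a.1 (act a.1 x))^-1 else c a.1 x) * cocycle w' (act a.1 x)
  else 1.

Lemma walk_cat u v x : walk (u ++ v) x = walk v (walk u x).
Proof. by elim: u x => //= a u IHu x. Qed.

Lemma walkV w x : V x -> V (walk w x).
Proof. by elim: w x => //= a w IHw x Vx; apply/IHw/actV. Qed.

Lemma cocycle_cat u v x : cocycle (u ++ v) x = cocycle u x * cocycle v (walk u x).
Proof. by elim: u x => [|a u IHu] x /=; rewrite ?mul1g // IHu mulgA. Qed.

Hypothesis rel_walk : forall u v x, R u v -> V x ->
  walk u x = walk v x /\ cocycle u x = cocycle v x.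

Lemma pres_eq_walk u v x : pres_eq R u v -> V x ->
  walk u x = walk v x /\ cocycle u x = cocycle v x.
Proof.
move=> uv; elim: uv x => {u v} [u v uv x|[i b] x Vx|//|u v _ IH x Vx
  |u v w _ IH1 _ IH2 x Vx|u u' v v' _ IHu _ IHv x Vx].
- exact: rel_walk.
- by case: b; rewrite /= !actK ?mulg1 ?mulVg ?mulgV.
- by have [-> ->] := IH x Vx.
- by have [-> ->] := IH1 x Vx; apply: IH2.
- rewrite !walk_cat !cocycle_cat; have [-> ->] := IHu x Vx.
  by have [-> ->] := IHv _ (walkV u' Vx).
Qed.

Definition pres_walk (g : presented R) : X -> X := walk (repr g).
Definition pres_cocycle (g : presented R) : X -> G := cocycle (repr g).

Lemma pres_cocycle_class w x : V x ->
  pres_walk (pres_class R w) x = walk w x /\ pres_cocycle (pres_class R w) x = cocycle w x.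
Proof. exact: (pres_eq_walk (repr_pres_class R w)). Qed.

Lemma pres_cocycleM g h x : V x ->
  pres_cocycle (g * h) x = pres_cocycle g x * pres_cocycle h (pres_walk g x).
Proof.
by move=> Vx; have [_ ->] := pres_cocycle_class (repr g ++ repr h) Vx; rewrite cocycle_cat.
Qed.

End Cocycle.

Lemma pres_classM (I : choiceType) (R : word I -> word I -> Prop) (u v : word I) :
  (pres_class R u * pres_class R v = pres_class R (u ++ v))%g.
Proof. exact: pres_mulE. Qed.

Lemma pres_classM3 (I : choiceType) (R : word I -> word I -> Prop) (u v w : word I) :
  (pres_class R u * pres_class R v * pres_class R w = pres_class R (u ++ v ++ w))%g.
Proof. by rewrite (pres_classM R u v) (pres_classM R (u ++ v) w) catA. Qed.

Lemma pres_classV (I : choiceType) (R : word I -> word I -> Prop) (a : letter I) :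
  (pres_class R [:: inv_letter a] = (pres_class R [:: a])^-1)%g.
Proof.
by apply/esym/mulg1_eq; rewrite pres_classM; apply/pres_classP/pres_eq_cancel.
Qed.

(** * Artin generators and generation of the pure braid group *)

Section BraidGroup.
Local Open Scope group_scope.
Variable n : nat.
Notation N := n.-1.
Notation B := (braid_group n).

(** The value 1 outside the range lets [sigma_comm] hold without bounds on the indices. *)
Definition sigma (i : nat) : B :=
  if insub i is Some j then pres_class (@braid_rel n) [:: gen j] else 1.

Lemma sigma_ord (i : 'I_N) : sigma i = pres_class (@braid_rel n) [:: gen i].
Proof. by rewrite /sigma valK. Qed.

Lemma sigma_braid i : (i.+1 < N)%N ->
  sigma i * sigma i.+1 * sigma i = sigma i.+1 * sigma i * sigma i.+1.
Proof.
move=> iN; have iN' : (i < N)%N by lia.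
rewrite (sigma_ord (Ordinal iN')) (sigma_ord (Ordinal iN)).
rewrite !pres_classM3; apply/pres_classP/pres_eq_rel.
exact: (@braid_rel_braid n (Ordinal iN') (Ordinal iN) erefl).
Qed.

Lemma sigma_comm i j : (i.+1 < j)%N -> commute (sigma i) (sigma j).
Proof.
move=> ij; rewrite /commute /sigma; case: insubP => [i' _ iE|]; last by rewrite mul1g mulg1.
case: insubP => [j' _ jE|]; last by rewrite mul1g mulg1.
rewrite !pres_classM; apply/pres_classP/pres_eq_sym/pres_eq_rel.
by apply: (@braid_rel_comm n i' j'); rewrite iE jE ij.
Qed.

Lemma span_braid (g : B) : span sigma N g.
Proof.
rewrite -(pres_class_repr g); elim: (repr g) => [|[i b] w IHw]; first exact: gen_by1.
rewrite -cat1s -pres_classM; apply: gen_byM => //.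
have si : span sigma N (sigma i) by apply: span_gen.
case: b; last by rewrite -sigma_ord.
by rewrite -[(i, true)]/(inv_letter (i, false)) pres_classV -sigma_ord; apply: gen_byV.
Qed.

Definition swap (i k : nat) : nat :=
  if k == i then i.+1 else if k == i.+1 then i else k.

Lemma swapK i : involutive (swap i).
Proof. by move=> k; rewrite /swap; do !case: eqP; lia. Qed.

Definition perm_nat (p : 'S_n) (k : nat) : nat := if insub k is Some j then p j else k.

Lemma perm_natM p q k : perm_nat (p * q) k = perm_nat q (perm_nat p k).
Proof.
rewrite /perm_nat; case: insubP => [j _ _|kn]; last by rewrite insubN.
by rewrite valK permM.
Qed.

Lemma perm_nat1 k : perm_nat 1 k = k.
Proof. by rewrite /perm_nat; case: insubP => // j _ <-; rewrite perm1. Qed.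

Lemma perm_nat_adj (i : 'I_N) k : perm_nat (adj_transposition i) k = swap i k.
Proof.
rewrite /perm_nat /swap /adj_transposition; case: insubP => [j _ jk|kn].
  rewrite -jk; case: tpermP => [->|->|/eqP]; rewrite ?eqxx //=; first by case: eqP => //; lia.
  by rewrite -val_eqE /= => /negPf-> /eqP; rewrite -val_eqE /= => /negPf->.
by rewrite !gtn_eqF //; have := ltn_ord i; lia.
Qed.

Definition pure (g : B) : Prop := braid_perm g = 1.

Lemma braid_permM : {morph @braid_perm n : x y / x * y}. Proof. exact: gmulfM. Qed.
Lemma braid_permV : {morph @braid_perm n : x / x^-1}. Proof. exact: gmulfV. Qed.
Lemma braid_perm1 : @braid_perm n 1 = 1. Proof. exact: gmulf1. Qed.

Lemma braid_perm_sigma (i : 'I_N) : braid_perm (sigma i) = adj_transposition i.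
Proof. by rewrite sigma_ord braid_perm_gen. Qed.

Lemma braid_perm_sigmaV i : braid_perm (sigma i)^-1 = braid_perm (sigma i).
Proof.
rewrite braid_permV /sigma; case: insubP => [j _ _|_]; last by rewrite braid_perm1 invg1.
by rewrite braid_perm_gen tpermV.
Qed.

Lemma pureM x y : pure x -> pure y -> pure (x * y).
Proof. by rewrite /pure braid_permM => -> ->; rewrite mulg1. Qed.

Lemma pureV x : pure x -> pure x^-1.
Proof. by rewrite /pure braid_permV => ->; rewrite invg1. Qed.

Lemma pureJ x g : pure x -> pure (x ^ g).
Proof.
by rewrite /pure /conjg braid_permM braid_permV braid_permM => ->; rewrite mul1g mulVg.
Qed.

Lemma pure_sq i : pure (sigma i * sigma i).
Proof. by rewrite /pure braid_permM -{1}braid_perm_sigmaV braid_permV mulVg. Qed.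

Definition strand (g : B) : nat -> nat := perm_nat (braid_perm g).

Lemma strandM g h k : strand (g * h) k = strand h (strand g k).
Proof. by rewrite /strand braid_permM perm_natM. Qed.

Lemma strand_sigma i k : (i < N)%N -> strand (sigma i) k = swap i k.
Proof.
by move=> iN; rewrite -[i]/(val (Ordinal iN)) /strand braid_perm_sigma perm_nat_adj.
Qed.

Lemma strand_pure g k : pure g -> strand g k = k.
Proof. by rewrite /strand => ->; apply: perm_nat1. Qed.

Lemma strand_fixV g k : strand g k = k -> strand g^-1 k = k.
Proof. by move=> gk; rewrite -{1}gk -strandM mulgV strand_pure //; apply: braid_perm1. Qed.

Lemma strand_span m g k : (m <= N)%N -> (m < k)%N -> span sigma m g -> strand g k = k.
Proof.
move=> mN mk; elim=> {g} [g [j jm ->]| |g h _ IHg _ IHh|g _ IHg].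
- by rewrite strand_sigma ?/swap; [do !case: eqP; lia | lia].
- by apply: strand_pure; apply: braid_perm1.
- by rewrite strandM IHg IHh.
- exact: strand_fixV.
Qed.

Lemma strand_asc i m : (i <= m)%N -> (m <= N)%N -> strand (asc sigma i m) i = m.
Proof.
elim: m => [|m IHm] im mN.
  by rewrite asc_nil //; have -> : i = 0%N by [lia]; apply/strand_pure/braid_perm1.
have [iE|im'] := eqVneq i m.+1.
  by rewrite iE asc_nil //; apply/strand_pure/braid_perm1.
by rewrite asc_recr 1?strandM ?IHm ?strand_sigma /swap ?eqxx; lia.
Qed.

Lemma pure_braid_twist i m : pure (twist sigma i m).
Proof. exact/pureJ/pure_sq. Qed.

(* Comb a pure braid strand by strand, the last one first. *)
Lemma pure_ind (K : B -> Prop) : K 1 ->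
  (forall x y, K x -> K y -> K (x * y)) -> (forall x, K x -> K x^-1) ->
  (forall i m, (i < m)%N -> (m <= N)%N -> K (twist sigma i m)) -> forall x, pure x -> K x.
Proof.
move=> K1 KM KV Kt x px; have := span_braid x; move: px; move: (leqnn N).
move: {1 3}N => m; elim: m x => [|m IHm] x mN px.
  suff E y : span sigma 0 y -> y = 1 by move=> /E ->.
  by elim=> {y} [y [j //]| //|y z _ -> _ ->|y _ ->]; rewrite ?mulg1 ?invg1.
move=> /(combed_span sigma_braid sigma_comm mN) [k [y [t [km ym tm xE]]]].
have [pt Kt'] : pure t /\ K t.
  elim: tm => {t xE} [t [i im ->]| |t u _ [pt Kt'] _ [pu Ku]|t _ [pt Kt']].
  - by split; [apply: pure_braid_twist | apply: Kt].
  - by split=> //; apply: braid_perm1.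
  - by split; [apply: pureM | apply: KM].
  - by split; [apply: pureV | apply: KV].
(* The factor [asc k m.+1] sends strand [k] to position [m.+1], which [y] and [t] fix; purity of [x]
   forces the two to agree. *)
have kE : k = m.+1.
  have := strand_pure k px; rewrite xE !strandM strand_asc // (strand_pure _ pt).
  by rewrite (@strand_span m) //; lia.
rewrite xE kE asc_nil // mul1g in px *.
have py : pure y by rewrite -[y](mulgK t); apply: pureM => //; apply: pureV.
by apply: KM => //; apply: IHm => //; lia.
Qed.

Lemma walk_swap (g : B) k : pres_walk (fun i : 'I_N => swap i) g k = strand g k.
Proof.
rewrite /pres_walk /strand /braid_perm /pres_lift.
elim: (repr g) k => [|[i b] w IHw] k /=; first by rewrite perm_nat1.
by rewrite IHw perm_natM /eval_letter /=; case: b; rewrite ?tpermV perm_nat_adj.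
Qed.

Lemma swap_braid i k : swap i (swap i.+1 (swap i k)) = swap i.+1 (swap i (swap i.+1 k)).
Proof. by rewrite /swap; do !case: eqP; lia. Qed.

Lemma swap_far i j k : (i.+1 < j)%N || (j.+1 < i)%N -> swap i (swap j k) = swap j (swap i k).
Proof. by move=> ij; rewrite /swap; do !case: eqP; lia. Qed.

(** * The projection to three strands modulo the center *)

Section Projection.
Variables (H : groupType) (u v : H).

Definition swap3 (i : nat) (p : nat * nat * nat) : nat * nat * nat :=
  let: (x, y, z) := p in (swap i x, swap i y, swap i z).

Definition distinct3 (p : nat * nat * nat) : Prop :=
  let: (x, y, z) := p in [&& x != y, y != z & x != z].

(* The strands starting at 0, 1, 2 have reached positions x, y, z. Only the
   crossings that undo one of their inversions are recorded; the values for the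
   first and last strands are forced by the braid relations. *)
Definition crossing (i : nat) (p : nat * nat * nat) : H :=
  let: (x, y, z) := p in
  if (x == i.+1) && (y == i) then u
  else if (y == i.+1) && (z == i) then v
  else if (x == i.+1) && (z == i) then
    (if (y < i)%N then (u * v)^-1 else (v * u)^-1)
  else 1.

Lemma swap3K i : involutive (swap3 i).
Proof. by move=> [[x y] z] /=; rewrite !swapK. Qed.

Lemma distinct_swap3 i p : distinct3 p -> distinct3 (swap3 i p).
Proof. by case: p => [[x y] z] /=; rewrite !(inj_eq (can_inj (swapK i))). Qed.

Lemma crossing_swap_far i j p : (i.+1 < j)%N || (j.+1 < i)%N ->
  crossing j (swap3 i p) = crossing j p.
Proof.
case: p => [[x y] z] ij.
have e k : (swap i k == j) = (k == j) by rewrite /swap; do !case: eqP; lia.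
have e' k : (swap i k == j.+1) = (k == j.+1) by rewrite /swap; do !case: eqP; lia.
have e'' k : (swap i k < j)%N = (k < j)%N by rewrite /swap; do !case: eqP; lia.
by rewrite /= !e !e' e''.
Qed.

(** A nontrivial value involves two of the three tracked strands, so disjoint crossings cannot both
    have one. *)
Lemma crossing_comm i j p : (i.+1 < j)%N || (j.+1 < i)%N -> distinct3 p ->
  commute (crossing i p) (crossing j p).
Proof.
case: p => [[x y] z] ij /= d.
have [i1|j1] : crossing i (x, y, z) = 1 \/ crossing j (x, y, z) = 1.
- rewrite /=; case: ifP => ?; [right|case: ifP => ?; [right|case: ifP => ?; [right|by left]]];
    by rewrite !ifF //; lia.
- by rewrite -[X in commute X]/(crossing i (x, y, z)) i1; apply/commute_sym/commute1.
- by rewrite -[X in commute _ X]/(crossing j (x, y, z)) j1; apply/commute1.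
Qed.

Lemma crossing_braid i p : distinct3 p ->
  let q := swap3 i p in let q' := swap3 i.+1 p in
  crossing i p * (crossing i.+1 q * crossing i (swap3 i.+1 q)) =
  crossing i.+1 p * (crossing i q' * crossing i.+1 (swap3 i q')).
Proof.
(* A position is one of the three being permuted, or it stays fixed and compares alike with [i] and
   [i.+1]. *)
have cls k : [\/ k = i, k = i.+1, k = i.+2 |
    (swap i k = k) * (swap i.+1 k = k) * ((k < i.+1) = (k < i))%N *
    ((k == i) = false) * ((k == i.+1) = false) * ((k == i.+2) = false)].
  have [->|ki] := eqVneq k i; first by constructor 1.
  have [->|ki1] := eqVneq k i.+1; first by constructor 2.
  have [->|ki2] := eqVneq k i.+2; first by constructor 3.
  constructor 4; rewrite /swap (negPf ki) (negPf ki1) (negPf ki2); do !split; lia.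
have e1 : ((i.+1 == i) = false) * ((i.+2 == i) = false) * ((i.+2 == i.+1) = false) *
    ((i == i.+1) = false) * ((i == i.+2) = false) * ((i.+1 == i.+2) = false).
  by do !split; lia.
have e2 : ((i < i) = false)%N * ((i < i.+1) = true)%N * ((i.+1 < i) = false)%N *
   ((i.+1 < i.+1) = false)%N * ((i.+2 < i) = false)%N * ((i.+2 < i.+1) = false)%N.
  by do !split; lia.
have e3 : (swap i i = i.+1) * (swap i i.+1 = i) * (swap i i.+2 = i.+2) *
   (swap i.+1 i = i) * (swap i.+1 i.+1 = i.+2) * (swap i.+1 i.+2 = i.+1).
  by rewrite /swap; do !split; rewrite ?eqxx ?e1.
case: p => [[x y] z]; rewrite /crossing /swap3 /distinct3.
have eE := (e1, e2, e3).
case: (cls x) => [->|->|->|xE];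
case: (cls y) => [->|->|->|yE];
case: (cls z) => [->|->|->|zE];
(* [?xE] does nothing in the branches where x has been replaced. *)
rewrite ?eqxx //= => _; rewrite ?eE ?xE ?yE ?zE ?eE ?xE ?yE ?zE ?eqxx ?andbF /=;
rewrite ?eE ?xE ?yE ?zE ?eE ?eqxx ?andbF /= ?mulg1 ?mul1g //.
all: try by case: ifP.
(* What remains are the three orders in which the third strand lies to the left of the first; there
   the values [(u * v)^-1] and [(v * u)^-1] make the two sides agree. *)
- by rewrite !invMg mulgVK mulVKg.
- by rewrite !invMg mulgVK mulVKg.
- by rewrite !invMg !mulgVK !mulgV.
Qed.

Lemma crossing_rel w w' p : braid_rel w w' -> distinct3 p ->
  walk (fun i : 'I_N => swap3 i) w p = walk (fun i : 'I_N => swap3 i) w' p /\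
  cocycle (fun i : 'I_N => swap3 i) (fun i : 'I_N => crossing i) w p =
  cocycle (fun i : 'I_N => swap3 i) (fun i : 'I_N => crossing i) w' p.
Proof.
case=> [i j ij|i j ij] d; rewrite /= !mulg1; split.
- by rewrite ij; case: p {d} => [[x y] z] /=; rewrite !swap_braid.
- by rewrite ij; apply: crossing_braid.
- by case: p {d} => [[x y] z] /=; rewrite !(swap_far _ ij).
- have ji : (j.+1 < i)%N || (i.+1 < j)%N by rewrite orbC.
  rewrite (crossing_swap_far p ij) (crossing_swap_far p ji).
  exact/commute_sym/crossing_comm.
Qed.

Let act3 := fun i : 'I_N => swap3 i.
Let act3K i : involutive (act3 i) := @swap3K i.
Let act3V (i : 'I_N) p := @distinct_swap3 i p.

Definition projection (g : B) : H :=
  pres_cocycle act3 (fun i : 'I_N => crossing i) g (0, 1, 2)%N.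

Lemma walk_swap3 g x y z :
  pres_walk act3 g (x, y, z) = (strand g x, strand g y, strand g z).
Proof.
rewrite -!walk_swap /pres_walk; elim: (repr g) x y z => //= a w IHw x y z.
Qed.

Lemma projectionM g h : (strand g 0, strand g 1, strand g 2) = (0, 1, 2)%N ->
  projection (g * h) = projection g * projection h.
Proof.
move=> g012; rewrite /projection.
rewrite (pres_cocycleM act3K act3V (fun u v p => @crossing_rel u v p)) //.
by rewrite walk_swap3 g012.
Qed.

Lemma projectionM_pure g h : pure g -> projection (g * h) = projection g * projection h.
Proof. by move=> pg; apply: projectionM; rewrite !(strand_pure _ pg). Qed.

Lemma projection_word w : projection (pres_class _ w) =
  cocycle act3 (fun i : 'I_N => crossing i) w (0, 1, 2)%N.
Proof.
by have [] := @pres_cocycle_class _ _ _ distinct3 _ _ _ act3K act3V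
  (fun u v p => @crossing_rel u v p) w (0, 1, 2)%N isT.
Qed.

Lemma projection_sq i (iN : (i < N)%N) : projection (sigma i * sigma i) =
  crossing i (0, 1, 2)%N * crossing i (swap3 i (0, 1, 2)%N).
Proof.
by rewrite (sigma_ord (Ordinal iN)) pres_classM projection_word /= mulg1.
Qed.

Lemma projection_high g : gen_by (fun y => exists2 j, (3 <= j < N)%N & y = sigma j) g ->
  projection g = 1 /\ (strand g 0, strand g 1, strand g 2) = (0, 1, 2)%N.
Proof.
have p1 : projection 1 = 1 by rewrite (projection_word [::]).
have s1 : (strand 1 0, strand 1 1, strand 1 2) = (0, 1, 2)%N.
  by rewrite !strand_pure //; apply: braid_perm1.
elim=> {g} [g [j /andP[j3 jN] ->]| |g h _ [pg sg] _ [ph sh]|g _ [pg sg]] //.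
- split; last by rewrite !strand_sigma // /swap; case: (j) j3 => [|[|[|]]].
  rewrite (sigma_ord (Ordinal jN)) projection_word /= mulg1.
  by case: (j) j3 => [|[|[|]]].
- rewrite projectionM // pg ph mulg1; split=> //; rewrite !strandM.
  by case: sg => -> -> ->.
- have sV : (strand g^-1 0, strand g^-1 1, strand g^-1 2) = (0, 1, 2)%N.
    by case: sg => g0 g1 g2; rewrite !strand_fixV.
  by have := projectionM g^-1 sg; rewrite mulgV p1 pg mul1g => <-.
Qed.

Lemma projection_twist k : (3 <= k)%N -> (k <= N)%N -> projection (twist sigma 2 k) = 1.
Proof.
move=> k3 kN; rewrite /twist; set g := asc _ _ _.
have gP : gen_by (fun y => exists2 j, (3 <= j < N)%N & y = sigma j) g.
  rewrite /g /asc big_seq; apply: big_ind => [|x y|j].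
  - exact: gen_by1.
  - exact: gen_byM.
  - by rewrite mem_index_iota => ?; apply: gen_by_mem; exists j => //; lia.
have [pg sg] := projection_high gP; have [pg' sg'] := projection_high (gen_byV gP).
rewrite /conjg projectionM // projectionM_pure; last exact: pure_sq.
by rewrite pg pg' projection_sq ?mulg1 ?mul1g //; lia.
Qed.

Lemma projection0 : (2 <= N)%N -> projection (sigma 0 * sigma 0) = u.
Proof. by move=> N2; rewrite projection_sq /= ?mul1g //; lia. Qed.

Lemma projection1 : (2 <= N)%N -> projection (sigma 1 * sigma 1) = v.
Proof. by move=> N2; rewrite projection_sq /= ?mul1g. Qed.

End Projection.

End BraidGroup.

(** * The exotic automorphism *)

Section Flip.
Local Open Scope group_scope.
Variable n : nat.
Hypothesis n3 : (3 <= n)%N.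
Notation N := n.-1.
Notation B := (braid_group n).
Notation s := (sigma n).

Let s_braid := @sigma_braid n.
Let s_comm := @sigma_comm n.

Fixpoint desc (m : nat) : B := if m is m'.+1 then s m' * desc m' else 1.

Lemma desc_shift j m : (j.+1 < m)%N -> (m <= N)%N -> s j * desc m = desc m * s j.+1.
Proof.
elim: m => [//|m IHm] jm mN /=.
have [{IHm}jE|jm'] := eqVneq j.+1 m; last first.
  have c : commute (s j) (s m) by apply: s_comm; lia.
  by rewrite mulgA c -!mulgA; congr (_ * _); apply: IHm; lia.
rewrite -jE /= !mulgA s_braid; last by lia.
suff c : commute (s j.+1) (desc j) by rewrite -!mulgA c.
have : (j <= j)%N by []; elim: {1 4}j => [|i IHi] ij /=; first exact: commute1.
by apply: commuteM; [apply/commute_sym/s_comm; lia | apply: IHi; lia].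
Qed.

(** The pure braid in which strand 0 travels once around all the others. *)
Definition loop : B := asc s 0 N * desc N.

Lemma loop_comm j : (0 < j < N)%N -> commute loop (s j).
Proof.
case: j => [//|j] /= jN; rewrite /commute /loop -mulgA -desc_shift //.
by rewrite !mulgA (asc_shift s_braid s_comm).
Qed.

(** These turn out to be the images of the [twist i N] under [flip]. With the inverse generators
    they form a family of type B whose special generator is [loop]. *)
Fixpoint flip_twist (i : nat) : B := if i is j.+1 then flip_twist j ^ (s j)^-1 else loop.

Lemma flip_twistS i : flip_twist i.+1 = flip_twist i ^ (s i)^-1.
Proof. by []. Qed.

Arguments flip_twist : simpl never.

Let sV i := (s i)^-1.

Let sV_braid i : (i.+1 < N.-1)%N -> sV i * sV i.+1 * sV i = sV i.+1 * sV i * sV i.+1.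
Proof. by move=> iN; rewrite /sV -!invMg !mulgA s_braid //; lia. Qed.

Let sV_comm i j : (i.+1 < j)%N -> commute (sV i) (sV j).
Proof. by move=> ij; apply: commuteV; apply/commuteVl/s_comm. Qed.

Lemma flip_twist_comm i j : (i < N)%N -> (j.+1 < N)%N -> j != i -> j.+1 != i ->
  commute (flip_twist i) (s j).
Proof.
move=> iN jN ji jSi; rewrite -[s j]invgK; apply: commuteV.
apply: (@artinB_comm _ N.-1 sV flip_twist) => //; try lia.
by move=> k kN; apply/commuteV/loop_comm; lia.
Qed.

Lemma desc1_comm m : (0 < m <= N)%N -> commute loop (desc m * (s 0)^-1).
Proof.
elim: m => [//|[|m] IHm] mN /=; first by rewrite mulg1 mulgV; apply: commute1.
by rewrite -mulgA; apply: commuteM; [apply: loop_comm; lia|apply: IHm; lia].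
Qed.

Lemma flip_twist_pair i : (i.+1 < N)%N -> commute (s i) (flip_twist i.+1 * flip_twist i).
Proof.
move=> iN; rewrite -[s i]invgK; apply: commuteVl.
apply: (@artinB_pair _ N.-1 sV flip_twist) => //; try lia.
  by move=> k kN; apply/commuteV/loop_comm; lia.
apply: commuteVl; rewrite flip_twistS -[flip_twist 0]/loop; set E := loop.
(* This is the loop from position 1 around the positions above it. It is a product of generators
   other than [s 0], so it commutes with [E]; this yields the relation of length four. *)
pose E1 := (s 0)^-1 * E * (s 0)^-1.
have EE1 : E = s 0 * E1 * s 0 by rewrite /E1 !mulgA mulgVK mulgV mul1g.
have c : commute E E1.
  have -> : E1 = asc s 1 N * (desc N * (s 0)^-1).
    by rewrite /E1 /E /loop asc_recl ?mulgA ?mulVg ?mul1g //; lia.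
  apply: commuteM; last by apply: desc1_comm; lia.
  by apply: asc_commute => j ?; apply: loop_comm; lia.
pose Y := s 0 * E1 * s 0 * E1 * s 0.
have YE : Y = E1 * s 0 * E1 * s 0 * s 0.
  by rewrite /Y -EE1 c {1}EE1 !mulgA.
have -> : E ^ (s 0)^-1 * E = s 0 * Y.
  by rewrite conjgE invgK {1 2}EE1 /Y !mulgA mulgK.
apply: commuteM; first exact: commute_refl.
by rewrite /commute {1}YE /Y !mulgA.
Qed.

(* The action on strand configurations of the half twist exchanging the last
   strand with the boundary of the disc, composed with a reflection; k is the
   current position of the last strand. The resulting involution maps s i to its
   inverse for i < N - 1, and twist 0 N to loop. *)
Definition flip_crossing (i k : nat) : B :=
  if k == i then 1 else if k == i.+1 then flip_twist i
  else if (i.+1 < k)%N then (s i)^-1 else (s i.-1)^-1.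

(** Away from the three positions involved this is the braid relation for inverse generators, with
    indices lowered by one when $k<i$. For $k=i+1$ it is the recursion for [flip_twist], and for
    $k=i+2$ it is [flip_twist_pair]. *)
Lemma flip_crossing_braid i k : (i.+1 < N)%N ->
  flip_crossing i k * (flip_crossing i.+1 (swap i k) *
    flip_crossing i (swap i.+1 (swap i k))) =
  flip_crossing i.+1 k * (flip_crossing i (swap i.+1 k) *
    flip_crossing i.+1 (swap i (swap i.+1 k))).
Proof.
move=> iN; have iN' : (i < N)%N by lia.
have tE : flip_twist i.+1 = s i * flip_twist i * (s i)^-1.
  by rewrite flip_twistS conjgE invgK mulgA.
have c : commute (s i)^-1 (flip_twist i.+1 * flip_twist i).
  exact/commuteVl/flip_twist_pair.
have bV j : (j.+1 < N)%N ->
    (s j)^-1 * ((s j.+1)^-1 * (s j)^-1) = (s j.+1)^-1 * ((s j)^-1 * (s j.+1)^-1).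
  by move=> jN; rewrite -!invMg s_braid.
have e1 : ((i.+1 == i) = false) * ((i.+2 == i) = false) * ((i.+2 == i.+1) = false) *
    ((i == i.+1) = false) * ((i == i.+2) = false) * ((i.+1 == i.+2) = false).
  by do !split; lia.
have e2 : ((i.+1 < i) = false)%N * ((i.+2 < i) = false)%N * ((i.+2 < i.+1) = false)%N *
   ((i.+1 < i.+1) = false)%N * ((i.+2 < i.+2) = false)%N * ((i.+1 < i.+2) = true)%N.
  by do !split; lia.
have [->|ki] := eqVneq k i; first by rewrite /flip_crossing /swap !(e1, e2, eqxx) /= ?mulg1 ?mul1g.
have [->|ki1] := eqVneq k i.+1.
  by rewrite /flip_crossing /swap !(e1, e2, eqxx) /= ?mulg1 ?mul1g tE !mulgA mulVg mul1g.
have [->|ki2] := eqVneq k i.+2.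
  by rewrite /flip_crossing /swap !(e1, e2, eqxx) /= c mulgA.
rewrite /flip_crossing /swap; do 3!rewrite ?(negPf ki) ?(negPf ki1) ?(negPf ki2) /=.
have [ki'|ik] := ltnP k i.
  have -> : (i.+1 < k)%N = false by lia.
  have -> : (i.+2 < k)%N = false by lia.
  have [j jE] : exists j, i = j.+1 by exists i.-1; lia.
  by rewrite jE /=; apply: bV; lia.
have -> : (i.+1 < k)%N by lia.
have -> : (i.+2 < k)%N by lia.
by rewrite /=; apply: bV.
Qed.

Lemma flip_crossing_far i j k : (i.+1 < j)%N -> (j < N)%N ->
  flip_crossing i k * flip_crossing j (swap i k) =
  flip_crossing j k * flip_crossing i (swap j k).
Proof.
move=> ij jN.
have c1 : commute (s i)^-1 (s j)^-1 by exact: sV_comm.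
have c2 : (i.+2 < j)%N -> commute (s i)^-1 (s j.-1)^-1 by move=> ?; apply: sV_comm; lia.
have c3 : (0 < i)%N -> commute (s i.-1)^-1 (s j.-1)^-1 by move=> ?; apply: sV_comm; lia.
have c4 : commute (flip_twist i) (s j.-1)^-1.
  by apply/commuteV/flip_twist_comm; lia.
have c5 : commute (flip_twist j) (s i)^-1.
  by apply/commuteV/flip_twist_comm; lia.
have e : [/\ (i == j) = false, (i == j.+1) = false, (i.+1 == j) = false & (i.+1 == j.+1) = false]
  by split; lia.
have e' : [/\ (j == i) = false, (j.+1 == i) = false, (j == i.+1) = false & (j.+1 == i.+1) = false]
  by split; lia.
case: e e' => e1 e2 e3 e4 [f1 f2 f3 f4].
have [g1 g2 g3 g4] : [/\ (j.+1 < i)%N = false, (j.+1 < i.+1)%N = false,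
  (i.+1 < j)%N = true & (i.+1 < j.+1)%N = true] by split; lia.
have g0 : ((i.+1 == i) = false) * ((j.+1 == j) = false) by split; lia.
have eE := (g0, e1, e2, e3, e4, (f1, f2, f3, f4), (g1, g2, g3, g4)).
rewrite /flip_crossing /swap.
have [->|ki] := eqVneq k i; first by do 3!rewrite ?eqxx ?eE /=; rewrite ?mulg1 ?mul1g.
have [->|ki1] := eqVneq k i.+1; first by do 3!rewrite ?eqxx ?eE /=; exact: c4.
have [->|kj] := eqVneq k j; first by do 3!rewrite ?eqxx ?eE /=; rewrite ?mulg1 ?mul1g.
have [->|kj1] := eqVneq k j.+1; first by do 3!rewrite ?eqxx ?eE /=; exact: (commute_sym c5).
do 3!rewrite ?(negPf ki) ?(negPf ki1) ?(negPf kj) ?(negPf kj1) /=.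
have [ik|ki'] := ltnP i.+1 k; last first.
  have -> : (j.+1 < k)%N = false by lia.
  by apply: c3; lia.
have [jk|kj'] := ltnP j.+1 k; first exact: c1.
by apply: c2; lia.
Qed.

Let act := fun i : 'I_N => swap i.
Let actK i : involutive (act i) := @swapK i.

Lemma flip_rel w w' k : braid_rel w w' -> True ->
  walk act w k = walk act w' k /\
  cocycle act (fun i : 'I_N => flip_crossing i) w k =
  cocycle act (fun i : 'I_N => flip_crossing i) w' k.
Proof.
case=> [i j ij|i j ij] _; rewrite /= !mulg1 /act; split.
- by rewrite ij swap_braid.
- by rewrite ij; apply: flip_crossing_braid; rewrite -ij.
- by rewrite (swap_far _ ij).
- by case/orP: ij => ij; rewrite (flip_crossing_far _ ij).
Qed.

Definition flip (g : B) : B := pres_cocycle act (fun i : 'I_N => flip_crossing i) g N.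

Lemma flipM g h : strand g N = N -> flip (g * h) = flip g * flip h.
Proof.
move=> gN; rewrite /flip.
rewrite (@pres_cocycleM _ _ _ (fun=> True) _ _ _ actK _ (fun w w' k => @flip_rel w w' k)) //.
by rewrite walk_swap gN.
Qed.

Lemma flip_word w : flip (pres_class _ w) =
  cocycle act (fun i : 'I_N => flip_crossing i) w N.
Proof.
by have [] := @pres_cocycle_class _ _ _ (fun=> True) _ _ _ actK (fun _ _ => id)
  (fun w w' k => @flip_rel w w' k) w N I.
Qed.

Lemma flip1 : flip 1 = 1.
Proof. exact: flip_word [::]. Qed.

Lemma flipV g : strand g N = N -> flip g^-1 = (flip g)^-1.
Proof. by move=> gN; apply/esym/mulg1_eq; rewrite -flipM // mulgV flip1. Qed.

Lemma flip_sigma i : (i.+1 < N)%N -> flip (s i) = (s i)^-1.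
Proof.
move=> iN; have iN' : (i < N)%N by lia.
rewrite (sigma_ord (Ordinal iN')) flip_word /= mulg1 /flip_crossing.
have -> : (N == i) = false by lia.
have -> : (N == i.+1) = false by lia.
by rewrite iN (sigma_ord (Ordinal iN')).
Qed.

Lemma flip_sq : flip (s N.-1 * s N.-1) = flip_twist N.-1.
Proof.
have iN : (N.-1 < N)%N by lia.
rewrite (sigma_ord (Ordinal iN)) pres_classM flip_word /= mulg1 /act /flip_crossing /swap /=.
have -> : (N == N.-1) = false by lia.
have -> : (N == N.-1.+1) = true by lia.
by rewrite eqxx mulg1.
Qed.

(** The second condition ensures that [flip g] fixes the last strand too, so that [flip] can be
    applied multiplicatively a second time. *)
Definition flipping (g : B) : Prop :=
  [/\ strand g N = N, braid_perm (flip g) = braid_perm g & flip (flip g) = g].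

Lemma flipping_strand g : flipping g -> strand (flip g) N = N.
Proof. by case=> gN pg _; rewrite /strand pg. Qed.

Lemma flipping1 : flipping 1.
Proof. by split; rewrite ?flip1 //; apply/strand_pure/braid_perm1. Qed.

Lemma flippingM g h : flipping g -> flipping h -> flipping (g * h).
Proof.
move=> fg fh; have fgN := flipping_strand fg; case: fg fh => [gN pg gg] [hN ph hh].
split; first by rewrite strandM gN hN.
  by rewrite flipM // !braid_permM pg ph.
by rewrite flipM // flipM // gg hh.
Qed.

Lemma flippingV g : flipping g -> flipping g^-1.
Proof.
move=> fg; have fgN := flipping_strand fg; case: fg => [gN pg gg].
split; first exact: strand_fixV.
  by rewrite flipV // !braid_permV pg.
by rewrite flipV // flipV // gg.
Qed.

Lemma flipping_sigma i : (i.+1 < N)%N -> flipping (s i).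
Proof.
move=> iN; have sN : strand (s i) N = N by rewrite strand_sigma /swap; [do !case: eqP|]; lia.
split=> //; first by rewrite flip_sigma // braid_perm_sigmaV.
by rewrite flip_sigma // flipV // flip_sigma // invgK.
Qed.

Lemma flipping_span g : span s N.-1 g -> flipping g.
Proof.
elim=> {g} [g [j jN ->]| |g h _ fg _ fh|g _ fg].
- by apply: flipping_sigma; lia.
- exact: flipping1.
- exact: flippingM.
- exact: flippingV.
Qed.

Lemma span_desc m m' : (m <= m')%N -> span s m' (desc m).
Proof.
elim: m => [|m IHm] mm /=; first exact: gen_by1.
by apply: gen_byM; [apply: span_gen | apply: IHm; lia].
Qed.

Lemma flip_asc m : (m < N)%N -> flip (asc s 0 m) = (desc m)^-1.
Proof.
elim: m => [|m IHm] mN; first by rewrite asc_nil // flip1 invg1.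
rewrite asc_recr // flipM; last first.
  by apply: (@strand_span _ m) => //; [lia.. | apply: span_asc].
by rewrite IHm ?flip_sigma /= ?invMg //; lia.
Qed.

Lemma flip_desc m : (m < N)%N -> flip (desc m) = (asc s 0 m)^-1.
Proof.
elim: m => [|m IHm] mN /=; first by rewrite asc_nil // flip1 invg1.
rewrite flipM; last by case: (@flipping_sigma m mN).
by rewrite asc_recr // IHm ?flip_sigma ?invMg //; lia.
Qed.

Lemma flip_twistE i : (i < N)%N -> flip_twist i = desc i * loop * (desc i)^-1.
Proof.
elim: i => [|i IHi] iN; first by rewrite mul1g invg1 mulg1.
by rewrite flip_twistS IHi ?conjgE ?invgK ?invMg ?mulgA //; lia.
Qed.

(** The image is [desc N.-1 * asc s 0 N.-1] times the square itself. The second flip inverts and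
    exchanges the two factors in front, so everything cancels but the square. *)
Lemma flipping_sq : flipping (s N.-1 * s N.-1).
Proof.
set q := s N.-1 * s N.-1.
have qN : strand q N = N by apply/strand_pure/pure_sq.
have N1 : (N.-1 < N)%N by lia.
have tE : flip_twist N.-1 = desc N.-1 * asc s 0 N.-1 * q.
  have N0 : (0 < N)%N by lia.
  have aE : asc s 0 N = asc s 0 N.-1 * s N.-1 by rewrite -{1}(prednK N0) asc_recr.
  have dE : desc N = s N.-1 * desc N.-1 by rewrite -{1}(prednK N0).
  by rewrite flip_twistE // /loop aE dE /q !mulgA mulgK.
have fd : flipping (desc N.-1) by apply/flipping_span/span_desc.
have fa : flipping (asc s 0 N.-1) by apply/flipping_span/span_asc.
have [dN pd _] := fd; have [aN pa _] := fa.
split=> //; rewrite flip_sq tE.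
  rewrite !braid_permM -pd flip_desc // braid_permV mulVg mul1g //.
rewrite flipM ?strandM ?dN // flipM // flip_desc // flip_asc // flip_sq tE.
by rewrite !mulgA mulgVK mulVg mul1g.
Qed.

Lemma flippingJ g h : flipping g -> flipping h ->
  flipping (g ^ h) /\ flip (g ^ h) = flip g ^ flip h.
Proof.
move=> fg fh; have fhV := flippingV fh.
split; first by apply: flippingM => //; apply: flippingM.
have [gN _ _] := fg; have [hN _ _] := fh; have [hVN _ _] := fhV.
by rewrite /conjg flipM // flipM // flipV.
Qed.

Lemma flip_twist_top i : (i < N)%N ->
  flipping (twist s i N) /\ flip (twist s i N) = flip_twist i.
Proof.
move=> iN; have [d dE] : exists d, (i + d.+1 = N)%N by exists (N - i.+1)%N; lia.
elim: d i iN dE => [|d IHd] i iN dE.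
  have iE : i = N.-1 by lia.
  have NE : N = i.+1 by lia.
  have -> : twist s i N = s N.-1 * s N.-1 by rewrite {1}NE twist_diag iE.
  by rewrite iE flip_sq; split=> //; apply: flipping_sq.
have iN' : (i.+1 < N)%N by lia.
have [||fi fE] := IHd i.+1; [lia..|].
have fs : flipping (s i) by apply: flipping_sigma.
have -> : twist s i N = twist s i.+1 N ^ (s i)^-1.
  by rewrite (twist_recl s_braid s_comm) // conjgK.
have [? ->] := flippingJ fi (flippingV fs); split=> //.
by case: fs => sN _ _; rewrite flipV // flip_sigma // invgK fE flip_twistS conjgKV.
Qed.

Lemma pure_flipping g : pure g -> flipping g.
Proof.
apply: pure_ind; [exact: flipping1|exact: flippingM|exact: flippingV|].
move=> i m im mN; have [->|mN'] := eqVneq m N; first by apply flip_twist_top; lia.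
by apply/flipping_span/span_twist; lia.
Qed.

Lemma flip_pure g : pure g -> pure (flip g).
Proof. by move=> pg; have [_ pf _] := pure_flipping pg; rewrite /pure pf. Qed.

Lemma flipK g : pure g -> flip (flip g) = g.
Proof. by case/pure_flipping. Qed.

Lemma flipM_pure g h : pure g -> pure h -> flip (g * h) = flip g * flip h.
Proof. by move=> pg ph; apply/flipM/strand_pure. Qed.

Lemma flip_sigma_sq i : (i.+1 < N)%N -> flip (s i * s i) = (s i * s i)^-1.
Proof.
by move=> iN; have [sN _ _] := flipping_sigma iN; rewrite flipM // flip_sigma // invMg.
Qed.

Lemma flip_asc_comm x i m : (m < N)%N ->
  (forall j, (i <= j < m)%N -> commute x (s j)) -> commute x (flip (asc s i m)).
Proof.
elim: m => [|m IHm] mN xs; first by rewrite asc_nil // flip1; apply: commute1.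
have [im|mi] := leqP i m; last by rewrite asc_nil // flip1; apply: commute1.
have fa : flipping (asc s i m) by apply/flipping_span/span_asc; lia.
have [aN _ _] := fa.
rewrite asc_recr // flipM // flip_sigma //; apply: commuteM.
  by apply: IHm => [|j ?]; [lia | apply: xs; lia].
by apply/commuteV/xs; lia.
Qed.

Lemma flip_twist_low_comm x i k : (i < k)%N -> (k < N)%N ->
  (forall j, (i <= j < k)%N -> commute x (s j)) -> commute x (flip (twist s i k)).
Proof.
move=> ik kN xs; have fa : flipping (asc s i.+1 k) by apply/flipping_span/span_asc; lia.
have fs : flipping (s i) by apply: flipping_sigma; lia.
have [sN _ _] := fs.
have [_ ->] := flippingJ (flippingM fs fs) fa; rewrite flipM // flip_sigma; last by lia.
have xi : commute x (s i)^-1 by apply/commuteV/xs; lia.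
apply: commuteJ; first exact: commuteM.
by apply: flip_asc_comm => // j ?; apply: xs; lia.
Qed.

Lemma flip_top_comm j : (0 < j < N)%N -> commute (flip (twist s 0 N)) (s j).
Proof. by move=> jN; have [_ ->] := @flip_twist_top 0 ltac:(lia); apply: loop_comm. Qed.

End Flip.

(** * Epimorphisms to free groups *)

Section InverseMorphism.
Variables (G H : groupType) (f : group_hom G H) (g : H -> G).
Hypotheses (fK : cancel f g) (gK : cancel g f).

HB.instance Definition _ := isUMagmaMorphism.Build H G g
  (conj (can2_gmulf1 fK gK) (can2_gmulfM fK gK)).

Definition inverse_hom : group_hom H G := g.

End InverseMorphism.

Lemma group_hom_inverse (G H : groupType) (f : group_hom G H) : bijective f ->
  exists g : group_hom H G, cancel f g /\ cancel g f.
Proof. by case=> g fK gK; exists (inverse_hom fK gK). Qed.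

(** * Factoring epimorphisms through the projection *)

Section PureBraidGroup.
Local Open Scope group_scope.
Variable n : nat.
Notation B := (braid_group n).
Notation P := (pure_braid_group n).
Notation pure := (@pure n).

Lemma pure_val (t : P) : pure (val t).
Proof. exact/eqP/(valP t). Qed.

(** Extending by 1 outside the pure braids turns a homomorphism on [P] into a [pure_hom] on the
    whole braid group. *)
Definition to_pure (x : B) : P := insubd (1 : P) x.

Lemma to_pureK x : pure x -> val (to_pure x) = x.
Proof. by move=> px; rewrite insubdK //; apply/eqP. Qed.

Lemma val_to_pure (t : P) : to_pure (val t) = t.
Proof. exact: valKd. Qed.

Lemma pure_hom_to_pure (H : groupType) (f : group_hom P H) : pure_hom pure (f \o to_pure).
Proof.
move=> x y px py /=; rewrite -gmulfM; congr (f _); apply: val_inj.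
have pxy := pureM px py.
by rewrite [RHS]gmulfM /= !to_pureK.
Qed.

Section Restrict.
Variables (H : groupType) (h : B -> H).
Hypothesis hM : pure_hom pure h.

Definition restrict_pure (t : P) : H := h (val t).

Lemma restrict_pureM : {morph restrict_pure : x y / x * y}.
Proof. by move=> x y; rewrite /restrict_pure [val _]gmulfM hM //; apply: pure_val. Qed.

Lemma restrict_pure1 : restrict_pure 1 = 1.
Proof. by apply: (mulgI (restrict_pure 1)); rewrite -restrict_pureM !mulg1. Qed.

HB.instance Definition _ := isUMagmaMorphism.Build P H restrict_pure
  (conj restrict_pure1 restrict_pureM).

Definition pure_restriction : group_hom P H := restrict_pure.

End Restrict.

Lemma pure_automorphism (phi psi : B -> B) : pure_hom pure phi ->
    (forall x, pure x -> pure (phi x)) -> (forall x, pure x -> pure (psi x)) ->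
    (forall x, pure x -> psi (phi x) = x) -> (forall x, pure x -> phi (psi x) = x) ->
  exists Phi : group_hom P P, bijective Phi /\ forall t, val (Phi t) = phi (val t).
Proof.
move=> phiM p_phi p_psi phiK psiK.
have to_phiM : pure_hom pure (to_pure \o phi).
  move=> x y px py; apply: val_inj; rewrite [RHS]gmulfM /= phiM //.
  by rewrite !to_pureK //; [exact: p_phi..|apply: pureM; exact: p_phi].
exists (pure_restriction to_phiM); have valE (t : P) : val (to_pure (phi (val t))) = phi (val t).
  by apply/to_pureK/p_phi/pure_val.
split=> //; exists (fun t => to_pure (psi (val t))) => t; apply: val_inj.
  by rewrite to_pureK; [rewrite valE phiK //|apply: p_psi]; do ?apply: pure_val; rewrite valE; apply/p_phi/pure_val.
have pt := pure_val t; rewrite valE to_pureK ?psiK //; exact: p_psi.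
Qed.

Hypothesis n3 : (3 <= n)%N.

Let N2 : (2 <= n.-1)%N. Proof. by lia. Qed.

Definition free_projection (H : groupType) (u v : H) : group_hom P H :=
  @pure_restriction H (projection (n := n) u v) (fun x y px _ => projectionM_pure u v y px).

Notation F := free_group.
Notation x0 := (fgen (ord0 : 'I_2)).
Notation x1 := (fgen (ord_max : 'I_2)).

Lemma free_projection_surj : surjective (free_projection x0 x1).
Proof.
have s0 : free_projection x0 x1 (to_pure (sigma n 0 * sigma n 0)) = x0.
  rewrite /= /restrict_pure to_pureK; last exact: pure_sq.
  exact: projection0.
have s1 : free_projection x0 x1 (to_pure (sigma n 1 * sigma n 1)) = x1.
  rewrite /= /restrict_pure to_pureK; last exact: pure_sq.
  exact: projection1.
pose q : group_hom (F 2) P := free_lift (fun i : 'I_2 =>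
  if i == ord0 then to_pure (sigma n 0 * sigma n 0) else to_pure (sigma n 1 * sigma n 1)).
move=> y; exists (q y).
apply: (@free_hom_ext _ _ (free_projection x0 x1 \o q) idfun) => i.
rewrite /= /q /= free_lift_gen; case: eqP => [->|/eqP i0]; first exact: s0.
have -> : i = ord_max by apply: val_inj; case: i i0 => [[|[|[]]]].
exact: s1.
Qed.

Lemma epi_factor k (f : group_hom P (F k)) : (2 <= k)%N -> surjective f ->
  exists (Phi : group_hom P P) (psi : group_hom (F 2) (F k)),
    bijective Phi /\ forall t, f (Phi t) = psi (free_projection x0 x1 t).
Proof.
move=> k2 f_surj; have fM := pure_hom_to_pure f.
pose i0 : 'I_k := Ordinal (ltnW k2); pose i1 : 'I_k := Ordinal k2.
(* Preimages of two distinct free generators witness that the image of [f] is not abelian. *)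
have [t0 t0E] := f_surj (fgen i0); have [t1 t1E] := f_surj (fgen i1).
have nc : ~ commute ((f \o to_pure) (val t0)) ((f \o to_pure) (val t1)).
  by rewrite /= !val_to_pure t0E t1E; apply: free_noncommutative.
have pure1 : pure 1 by exact: braid_perm1.
have s_braid := @sigma_braid n; have s_comm := @sigma_comm n.
have pM := @pureM n; have pV := @pureV n; have pJ := @pureJ n; have pS := @pure_sq n.
have pI := @pure_ind n.
have [g [b [nc' tr]]] : exists (g : B) (b : bool),
    let h' := fun z : B => (f \o to_pure) ((if b then flip z else z) ^ g) in
    noncommuting (sigma n) h' /\ trivial_type n.-1 (sigma n) h'.
  apply: (exists_trivial_type s_braid s_comm pure1 pM pV pJ pS pI (@free_commute_trans k) N2
    _ _ _ _ _ _ fM (pure_val t0) (pure_val t1) nc).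
  - by move=> x y px py; apply: flipM_pure.
  - by move=> x px; apply: flip_pure.
  - exact: flip_sigma_sq.
  - by move=> N3; apply: flip_sigma_sq.
  - by move=> j x j3 jN; apply: flip_twist_low_comm; lia.
  - exact: flip_top_comm.
pose phi z := (if b then flip z else z) ^ g.
pose psi z := if b then flip (z ^ g^-1) else z ^ g^-1.
have phiM : pure_hom pure phi.
  by move=> x y px py; rewrite /phi; case: (b); rewrite ?flipM_pure // conjMg.
have p_phi x : pure x -> pure (phi x).
  by move=> px; apply: pJ; case: (b) => //; apply: flip_pure.
have p_psi x : pure x -> pure (psi x).
  by move=> px; rewrite /psi; case: (b); [apply: flip_pure => //|]; apply: pJ.
have [||Phi [Phi_bij PhiE]] := pure_automorphism phiM p_phi p_psi.
- by move=> x px; rewrite /phi /psi; case: (b); rewrite conjgK ?flipK.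
- move=> x px; rewrite /phi /psi; case: (b); rewrite ?flipK ?conjgKV //; exact: pJ.
pose h z := (f \o to_pure) (phi z).
have hM : pure_hom pure h by move=> x y px py; rewrite /h phiM // fM //; apply: p_phi.
pose ps : group_hom (F 2) (F k) := free_lift (fun i : 'I_2 =>
  if i == ord0 then h (sigma n 0 * sigma n 0) else h (sigma n 1 * sigma n 1)).
(* Both [h] and [h'] are of trivial type and agree on $A_{01}$ and $A_{12}$, hence on all pure
   braids by [trivial_type_ext]. *)
pose h' z := ps (projection (n := n) x0 x1 z).
have h'M : pure_hom pure h' by move=> x y px py; rewrite /h' projectionM_pure // gmulfM.
have e0 : h (sigma n 0 * sigma n 0) = h' (sigma n 0 * sigma n 0).
  by rewrite /h' projection0 // /ps /= free_lift_gen.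
have e1 : h (sigma n 1 * sigma n 1) = h' (sigma n 1 * sigma n 1).
  by rewrite /h' projection1 // /ps /= free_lift_gen.
exists Phi, ps; split=> // t.
have -> : f (Phi t) = h (val t) by rewrite /h /= -PhiE val_to_pure.
apply: (trivial_type_ext s_braid s_comm pure1 pM pV pJ pS pI (@free_commute_trans k) N2
  hM nc' tr h'M _ _ e0 e1 (pure_val t)).
  by rewrite /noncommuting -e0 -e1.
by move=> j j3 jN; rewrite /h' projection_twist // gmulf1.
Qed.

End PureBraidGroup.

Theorem theorem3p5 (n k : nat) (hn : (3 <= n)%N) (hk : (2 <= k)%N) :
  ((3 <= k)%N ->
     ~ exists f : group_hom (pure_braid_group n) (free_group k), surjective f)
  /\
  (k = 2 ->
     (exists f : group_hom (pure_braid_group n) (free_group k), surjective f)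
     /\
     (forall f g : group_hom (pure_braid_group n) (free_group k),
        surjective f -> surjective g -> equivalent_epi f g)).
Proof.
have psi_surj (f : group_hom (pure_braid_group n) (free_group k)) Phi
    (psi : group_hom (free_group 2) (free_group k)) p :
    surjective f -> bijective Phi -> (forall t, f (Phi t) = psi (p t)) -> surjective psi.
  move=> f_surj [Phi' PhiK Phi'K] E y; have [t tE] := f_surj y.
  by exists (p (Phi' t)); rewrite -E Phi'K.
split=> [k3 [f f_surj]|k2].
  have [Phi [psi [Phi_bij E]]] := epi_factor hn hk f_surj.
  by have := free_epi_rank (psi_surj _ _ _ _ _ f_surj Phi_bij E); lia.
subst k; split; first by eexists; apply: (free_projection_surj hn).
move=> f g f_surj g_surj.
have [Phi [psi [Phi_bij fE]]] := epi_factor hn hk f_surj.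
have [Phi' [psi' [Phi'_bij gE]]] := epi_factor hn hk g_surj.
have psi_bij := free_hopfian (psi_surj _ _ _ _ _ f_surj Phi_bij fE).
have psi'_bij := free_hopfian (psi_surj _ _ _ _ _ g_surj Phi'_bij gE).
have [iPhi [PhiK iPhiK]] := group_hom_inverse Phi_bij.
have [ipsi [psiK ipsiK]] := group_hom_inverse psi_bij.
(* Up to automorphisms of source and target, [f] and [g] are the same projection; going from [f]
   back to it and on to [g] gives the two witnesses. *)
exists (Phi' \o iPhi), (psi' \o ipsi); split; rewrite /=.
- by apply: bij_comp => //; exists Phi.
- by apply: bij_comp => //; exists psi.
- by move=> x; rewrite gE -{2}[x]iPhiK fE psiK.
Qed.
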